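(* Let $X$ be a real Banach space containing an isomorphic copy of $c_0$ and possessing a countable norming system of functionals. Then $X$ is isomorphic to a Banach space $\widetilde X$ such that $\operatorname{span}(\mathrm{NA}(\widetilde X))$ is weak-star modest in $\widetilde X^*$. Therefore, the norm $p(x)=\|x\|_{\widetilde X}+\|R(x)\|_{\ell_1}$ on $\widetilde X$, built from the norm of $\widetilde X$ by the construction described in the context, is a Read norm (so that, via the isomorphism, $X$ admits an equivalent Read norm).
   Context: All Banach spaces are real. $\mathrm{NA}(X)$ is the set of all $f\in X^*$ with $\|f\|=|f(x)|$ for some $x\in S_X$ (unit sphere); $\mathrm{NA}(X,p)$ is the same set when $X$ is endowed with the equivalent norm $p$. An equivalent norm $p$ on $X$ is a Read norm if $\mathrm{NA}(X,p)$ does not contain any two-dimensional linear subspace. A countable norming system of functionals of $X$ is a bounded subset $\{x_n^*: n\in\mathbb N\}$ of $X^*$ for which there is a constant $K\ge 0$ with $\|x\|\le K\sup_n|x_n^*(x)|$ for all $x\in X$. A linear subspace $Y$ of a Banach space $V$ is an operator range if there are an infinite-dimensional Banach space $E$ and a bounded injective linear operator $T\colon E\to V$ with $T(E)=Y$. A linear subspace $Z$ of a dual space $V^*$ is weak-star modest if there is a (norm-)separable weak-star dense operator range $Y\subset V^*$ with $Z\cap Y=\{0\}$. Construction of $p$ on a Banach space $(V,\|\cdot\|)$ with $\operatorname{span}(\mathrm{NA}(V))$ weak-star modest in $V^*$: take a separable weak-star dense operator range $Y\subset V^*$ with $Y\cap\operatorname{span}(\mathrm{NA}(V))=\{0\}$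 which is of the form $Y=T(\ell_1)$ for an injective norm-one linear operator $T\colon\ell_1\to V^*$ such that $\{Te_n/\|Te_n\| : n\in\mathbb N\}$ is norm dense in $S_Y=\{y\in Y:\|y\|=1\}$, where $(e_n)$ is the canonical basis of $\ell_1$ (such $Y$ and $T$ exist). Put $v_n^*=Te_n$, take positive reals $r_n$ with $\sum_n r_n<\infty$, define $R\colon V\to\ell_1$ by $[R(x)](n)=r_n v_n^*(x)$, and set $p(x)=\|x\|+\|R(x)\|_{\ell_1}$ for $x\in V$. *)

(* Defs.v *)
From HB Require Import structures.
From mathcomp Require Import all_boot all_order all_algebra.
From mathcomp Require Import all_classical all_reals all_analysis.

Set Implicit Arguments.
Unset Strict Implicit.
Unset Printing Implicit Defensive.

Import Order.TTheory GRing.Theory Num.Theory.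
Import numFieldNormedType.Exports.

Local Open Scope classical_set_scope.
Local Open Scope ring_scope.

Section sup_real.
Context {R : realType}.

Lemma sup_ub_le (A : set R) (M x : R) :
  (forall y, A y -> y <= M) -> A x -> x <= sup A.
Proof.
move=> AM Ax; apply: ub_le_sup => //.
by exists M => y; exact: AM.
Qed.

Lemma sup_le_ub0 (A : set R) (M : R) :
  0 <= M -> (forall y, A y -> y <= M) -> sup A <= M.
Proof.
move=> M0 AM; have [->|/set0P A0] := eqVneq A set0; first by rewrite sup0.
by apply: ge_sup => // y; exact: AM.
Qed.

End sup_real.

(* Completeness of a normed space of scalar families, from evaluations that are
   bounded and closed balls that are stable under pointwise limits *)
Lemma complete_ptws {R : realType} (W : normedModType R) (I : Type)
    (ev : I -> {linear W -> R^o}) :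
  (forall i, exists2 C : R, 0 <= C & forall w, `|ev i w| <= C * `|w|) ->
  (forall w, (forall i, ev i w = 0) -> w = 0) ->
  (forall (F : set_system W) (g : I -> R) w0 M, ProperFilter F ->
    (forall i, ev i w @[w --> F] --> g i) -> 0 <= M ->
    (\forall w \near F, `|w - w0| <= M) ->
    exists2 w, (forall i, ev i w = g i) & `|w - w0| <= M) ->
  forall F : set_system W, ProperFilter F -> cauchy F -> cvg F.
Proof.
move=> evC ev0 clos F FF /cauchy_ballP Fc.
have Fle (e : R) : 0 < e -> \forall w0 \near F, \forall w \near F, `|w - w0| <= e.
  move=> /Fc /nearP_dep; apply: filterS => w0; apply: filterS => w.
  by rewrite -ball_normE/= distrC => /ltW.
have Fi i : cvg (ev i w @[w --> F]).
  have [C C0 evb] := evC i.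
  apply/cauchy_cvgP/cauchy_exP => e e0.
  have e1 : 0 < e / 2 / (C + 1) by rewrite !divr_gt0// ltr_wpDl.
  have /filter_ex[w0 Fw0] := Fle _ e1.
  exists (ev i w0); apply: filterS Fw0 => w ww0.
  rewrite -ball_normE/= -linearB (le_lt_trans (evb _))// distrC.
  rewrite (@le_lt_trans _ _ (C * (e / 2 / (C + 1))))// ?ler_wpM2l//.
  rewrite mulrA ltr_pdivrMr ?ltr_wpDl// mulrC.
  rewrite (@le_lt_trans _ _ (e / 2 * (C + 1)))// ?ler_wpM2l ?lerDl//.
    by rewrite divr_ge0// ltW.
  by rewrite ltr_pM2r ?ltr_wpDl// gtr_pMr// invf_lt1// ltr1n.
pose g i := lim (ev i w @[w --> F]).
have uniq w w' : (forall i, ev i w = g i) -> (forall i, ev i w' = g i) -> w = w'.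
  move=> wg w'g; apply/eqP; rewrite -subr_eq0; apply/eqP/ev0 => i.
  by rewrite linearB /= wg w'g subrr.
have /filter_ex[w1 /(clos F g _ _ FF Fi ler01)[w wg _]] := Fle 1 ltr01.
apply/cvg_ex; exists w; apply/cvgrPdist_le => e e0.
apply: filterS (Fle _ e0) => w0 /(clos F g _ _ FF Fi (ltW e0))[w' w'g].
by rewrite (uniq w w').
Qed.

Lemma seminorm_homog {R : realType} (W : lmodType R) (nm : W -> R) :
  (forall u, 0 <= nm u) -> (forall a u, nm (a *: u) <= `|a| * nm u) ->
  forall a u, nm (a *: u) = `|a| * nm u.
Proof.
move=> nm_ge0 nmZ a u; apply/eqP; rewrite eq_le nmZ/=.
have [->|a0] := eqVneq a 0; first by rewrite normr0 mul0r.
have := nmZ a^-1 (a *: u).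
by rewrite scalerA mulVf// scale1r normfV mulrC ler_pdivlMr ?normr_gt0// mulrC.
Qed.

Definition cont_functional {R : realType} {V : normedModType R} :
  {pred V -> R} := mem [set f : V -> R | linear (f : V -> R^o) /\ continuous f].

Record dual {R : realType} (V : normedModType R) := Dual {
  dual_fun :> V -> R ;
  dualP : dual_fun \in cont_functional }.

(* The norm of a functional when V carries the (possibly non-original) norm p *)
Definition dual_norm {R : realType} {V : normedModType R} (p : V -> R)
    (f : V -> R) : R := sup [set `|f x| | x in [set x | p x <= 1]].

Section dual_lmod.
Context {R : realType} {V : normedModType R}.

HB.instance Definition _ := [isSub for @dual_fun R V].
HB.instance Definition _ := [Choice of dual V by <:].

Lemma cont_functional_submod_closed : submod_closed (@cont_functional R V).
Proof.
split=> [|a f g]; first by rewrite inE; split=> [b x y|x];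
  [rewrite /= scaler0 addr0|exact: cvg_cst].
rewrite !inE => -[fl fc] [gl gc]; split=> [b x y|x].
  rewrite /= !fctE fl gl !scalerDr !scalerA [b * a]mulrC.
  by rewrite -!addrA; congr (_ + _); rewrite addrCA.
apply: cvgD; last exact: gc.
by apply: cvgZr; exact: fc.
Qed.

HB.instance Definition _ := GRing.isSubmodClosed.Build R (V -> R)
  (@cont_functional R V) cont_functional_submod_closed.
HB.instance Definition _ := [SubChoice_isSubLmodule of dual V by <:].

Lemma dual_linear (f : dual V) : linear (f : V -> R^o).
Proof. by have := dualP f; rewrite inE => -[]. Qed.

HB.instance Definition _ (f : dual V) :=
  GRing.isLinear.Build R V R^o *:%R (f : V -> R^o) (dual_linear f).

Lemma dual_continuous (f : dual V) : continuous f.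
Proof. by have := dualP f; rewrite inE => -[]. Qed.

Lemma cont_functional_bounded (f : V -> R) (l : linear (f : V -> R^o)) :
  continuous f <-> exists M, forall x, `|f x| <= M * `|x|.
Proof.
pose g : {linear V -> R^o} := HB.pack f (GRing.isLinear.Build _ _ _ _ _ l).
have -> : f = g by [].
split=> [/linear_bounded_continuous/linear_boundedP|[M fM]].
  move=> fM; near (pinfty_nbhs R) => M; exists M; near: M; exact: fM.
apply/linear_bounded_continuous/linear_boundedP.
near=> N => x; apply: (le_trans (fM x)); apply: ler_wpM2r => //.
Unshelve. all: by end_near. Qed.

End dual_lmod.

Section dual_normed.
Context {R : realType} {V : normedModType R}.
Implicit Types f g : dual V.

Lemma dual_norm_le f M :
  0 <= M -> (forall x, `|x| <= 1 -> `|f x| <= M) -> dual_norm Num.norm f <= M.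
Proof.
by move=> M0 fM; apply: sup_le_ub0 => // _ [x x1 <-]; exact: fM.
Qed.

Lemma dual_norm_ub f x : `|x| <= 1 -> `|f x| <= dual_norm Num.norm f.
Proof.
move=> x1.
have [M fM] : exists M, forall x, `|f x| <= M * `|x|.
  by apply/cont_functional_bounded; [exact: dual_linear|exact: dual_continuous].
apply: (@sup_ub_le _ _ `|M|); last by exists x.
move=> _ [y y1 <-]; apply: (le_trans (fM y)).
rewrite (le_trans (ler_norm _))// normrM normr_id.
by rewrite -[leRHS]mulr1 ler_wpM2l.
Qed.

Lemma dual_norm_ge0 f : 0 <= dual_norm Num.norm f.
Proof. by rewrite (le_trans _ (@dual_norm_ub f 0 _)) ?normr0. Qed.

Lemma dual_norm_bound f x : `|f x| <= dual_norm Num.norm f * `|x|.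
Proof.
have [->|x0] := eqVneq x 0; first by rewrite linear0 !normr0 mulr0.
have xp : 0 < `|x| by rewrite normr_gt0.
rewrite -ler_pdivrMr//.
have := @dual_norm_ub f (`|x|^-1 *: x).
rewrite linearZ/= !normrM normfV normr_id mulrC; apply.
by rewrite normrZ normfV normr_id mulVf ?gt_eqF.
Qed.

Let dual_normD f g :
  dual_norm Num.norm (f + g) <=
  dual_norm Num.norm f + dual_norm Num.norm g.
Proof.
apply: dual_norm_le => [|x x1]; first by rewrite addr_ge0// dual_norm_ge0.
by rewrite (le_trans (ler_normD _ _))// lerD// dual_norm_ub.
Qed.

Let dual_normZ_le (a : R) f :
  dual_norm Num.norm (a *: f) <= `|a| * dual_norm Num.norm f.
Proof.
apply: dual_norm_le => [|x x1]; first by rewrite mulr_ge0// dual_norm_ge0.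
by rewrite [leLHS]normrM ler_wpM2l// dual_norm_ub.
Qed.

Let dual_normZ (a : R) f :
  dual_norm Num.norm (a *: f) = `|a| * dual_norm Num.norm f.
Proof. exact: seminorm_homog dual_norm_ge0 dual_normZ_le a f. Qed.

Let dual_norm0 f : dual_norm Num.norm f = 0 -> f = 0.
Proof.
move=> f0; apply/val_inj/funext => x.
by apply/normr0_eq0/le_anti; rewrite normr_ge0 andbT
  (le_trans (dual_norm_bound f x))// f0 mul0r.
Qed.

HB.instance Definition _ :=
  @Lmodule_isNormed.Build R (dual V) (fun f => dual_norm Num.norm f)
    dual_normD dual_normZ dual_norm0.

Lemma ler_dual f x : `|f x| <= `|f| * `|x|.
Proof. exact: dual_norm_bound. Qed.

Let ev (x : V) (f : dual V) : R^o := f x.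

Let ev_linear x : linear (ev x). Proof. by []. Qed.

HB.instance Definition _ x :=
  GRing.isLinear.Build R (dual V) R^o *:%R (ev x) (ev_linear x).

Lemma dual_complete (F : set_system (dual V)) :
  ProperFilter F -> cauchy F -> cvg F.
Proof.
apply: (@complete_ptws _ _ V (fun x => ev x : {linear dual V -> R^o})).
- by move=> x; exists `|x| => // f; rewrite mulrC; exact: ler_dual.
- by move=> f f0; apply/val_inj/funext.
move=> {}F g f0 M FF Fg M0 FM.
have gl : linear (g : V -> R^o).
  move=> a x y; apply: (cvg_unique (@norm_hausdorff _ R^o)
    (Fg (a *: x + y)) _) => /=.
  rewrite (_ : (fun f => ev (a *: x + y) f) = (fun f => a *: ev x f + ev y f)).
    by apply: cvgD; [apply: cvgZl_tmp; exact: Fg|exact: Fg].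
  by apply/funext => f; rewrite /ev linearP.
have gM x : `|g x - f0 x| <= M * `|x|.
  have gx : (fun f => `|ev x f - f0 x|) @ F --> `|g x - f0 x|.
    by apply: cvg_norm; apply: cvgB; [exact: Fg|exact: cvg_cst].
  rewrite -(cvg_lim _ gx)//; apply: limr_le; first by apply/cvg_ex; eexists; exact: gx.
  apply: filterS FM => f fM; rewrite (le_trans (ler_dual (f - f0) x))//.
  exact: ler_wpM2r.
have gc : continuous g.
  apply/(cont_functional_bounded gl); exists (M + `|f0|) => x.
  rewrite -[g x](subrK (f0 x)) (le_trans (ler_normD _ _))// mulrDl lerD//.
  exact: ler_dual.
have gd : g \in cont_functional by rewrite inE.
exists (Dual gd) => //; apply: dual_norm_le => // x x1.
by rewrite (le_trans (gM x))// -[leRHS]mulr1 ler_wpM2l.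
Qed.

HB.instance Definition _ := Uniform_isComplete.Build (dual V)
  dual_complete.

End dual_normed.

Definition null_seq {R : realType} : {pred nat -> R} :=
  mem [set u : nat -> R | u @ \oo --> (0 : R)].

Record c0 (R : realType) := C0 {
  c0_fun :> nat -> R ;
  c0P : c0_fun \in null_seq }.

Section c0.
Context {R : realType}.

HB.instance Definition _ := [isSub for @c0_fun R].
HB.instance Definition _ := [Choice of c0 R by <:].

Lemma null_seq_submod_closed : submod_closed (@null_seq R).
Proof.
split=> [|a u v]; first by rewrite inE; exact: cvg_cst.
rewrite !inE => u0 v0; rewrite -[0]addr0 -[X in X + _](mulr0 a).
by apply: cvgD => //; apply: (@cvgZl_tmp _ R^o).
Qed.

HB.instance Definition _ := GRing.isSubmodClosed.Build R (nat -> R)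
  (@null_seq R) null_seq_submod_closed.
HB.instance Definition _ := [SubChoice_isSubLmodule of c0 R by <:].

Let nm (u : c0 R) : R := sup (range (fun n => `|u n|)).

Let nm_ub (u : c0 R) n : `|u n| <= nm u.
Proof.
have [M uM] : has_ubound (range (fun n => `|u n|)).
  have := c0P u; rewrite inE => u0.
  by apply: cvg_has_ub; apply/cvg_ex; exists 0.
by apply: (@sup_ub_le _ _ M) => //; exists n.
Qed.

Let nm_le (u : c0 R) M : (forall n, `|u n| <= M) -> nm u <= M.
Proof.
move=> uM; apply: sup_le_ub0 => [|_ [n _ <-]//].
by rewrite (le_trans _ (uM 0%N)).
Qed.

Let nm_ge0 u : 0 <= nm u. Proof. by rewrite (le_trans _ (nm_ub u 0%N)). Qed.

Let nmD u v : nm (u + v) <= nm u + nm v.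
Proof.
by apply: nm_le => n; rewrite (le_trans (ler_normD _ _))// lerD ?nm_ub.
Qed.

Let nmZ_le a u : nm (a *: u) <= `|a| * nm u.
Proof. by apply: nm_le => n; rewrite [leLHS]normrM ler_wpM2l ?nm_ub. Qed.

Let nm0 u : nm u = 0 -> u = 0.
Proof.
move=> u0; apply/val_inj/funext => n; apply/normr0_eq0/le_anti.
by rewrite normr_ge0 andbT -u0 nm_ub.
Qed.

Let nmZ a u : nm (a *: u) = `|a| * nm u.
Proof. exact: seminorm_homog nm_ge0 nmZ_le a u. Qed.

HB.instance Definition _ := @Lmodule_isNormed.Build R (c0 R) nm nmD nmZ nm0.

Lemma c0_norm_ub (u : c0 R) n : `|u n| <= `|u|. Proof. exact: nm_ub. Qed.

Lemma c0_norm_le (u : c0 R) M : (forall n, `|u n| <= M) -> `|u| <= M.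
Proof. exact: nm_le. Qed.

End c0.

Definition summable_seq {R : realType} : {pred nat -> R} :=
  mem [set u : nat -> R | cvgn (series (fun n => `|u n|))].

Record l1 (R : realType) := L1 {
  l1_fun :> nat -> R ;
  l1P : l1_fun \in summable_seq }.

Section l1.
Context {R : realType}.

HB.instance Definition _ := [isSub for @l1_fun R].
HB.instance Definition _ := [Choice of l1 R by <:].

Let psum_nd (u : nat -> R) : nondecreasing_seq (series (fun n => `|u n|)).
Proof. by apply: nondecreasing_series. Qed.

Let psum_le (u : nat -> R) n : u \in summable_seq ->
  \sum_(0 <= k < n) `|u k| <= limn (series (fun n => `|u n|)).
Proof. by rewrite inE => uc; apply: (nondecreasing_cvgn_le (psum_nd u)). Qed.

Lemma summable_seqP (u : nat -> R) :
  u \in summable_seq <-> exists M, forall n, \sum_(0 <= k < n) `|u k| <= M.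
Proof.
split=> [us|[M uM]]; first by eexists => n; exact: psum_le us.
rewrite inE; apply: nondecreasing_is_cvgn; first exact: psum_nd.
by exists M => _ [n _ <-]; exact: uM.
Qed.

Let lim_le (u : nat -> R) M : u \in summable_seq ->
  (forall n, \sum_(0 <= k < n) `|u k| <= M) ->
  limn (series (fun n => `|u n|)) <= M.
Proof. by rewrite inE => uc uM; apply: limr_le => //; exact: nearW. Qed.

Let psumD (u v : nat -> R) n : \sum_(0 <= k < n) `|u k + v k| <=
  \sum_(0 <= k < n) `|u k| + \sum_(0 <= k < n) `|v k|.
Proof. by rewrite -big_split ler_sum// => k _; exact: ler_normD. Qed.

Let psumZ a (u : nat -> R) n : \sum_(0 <= k < n) `|a * u k| =
  `|a| * \sum_(0 <= k < n) `|u k|.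
Proof. by rewrite mulr_sumr; apply: eq_bigr => k _; rewrite normrM. Qed.

Lemma summable_seq_submod_closed : submod_closed (@summable_seq R).
Proof.
split=> [|a u v].
  apply/summable_seqP; exists 0 => n.
  by rewrite big1// => k _; rewrite normr0.
move=> /summable_seqP[M uM] /summable_seqP[N vN]; apply/summable_seqP.
exists (`|a| * M + N) => n; rewrite (le_trans (psumD _ _ n))// lerD//.
by rewrite psumZ ler_wpM2l.
Qed.

HB.instance Definition _ := GRing.isSubmodClosed.Build R (nat -> R)
  (@summable_seq R) summable_seq_submod_closed.
HB.instance Definition _ := [SubChoice_isSubLmodule of l1 R by <:].

Let nm (u : l1 R) : R := limn (series (fun n => `|u n|)).

Let nm_ub (u : l1 R) n : \sum_(0 <= k < n) `|u k| <= nm u.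
Proof. exact/psum_le/l1P. Qed.

Let nm_le (u : l1 R) M : (forall n, \sum_(0 <= k < n) `|u k| <= M) -> nm u <= M.
Proof. exact/lim_le/l1P. Qed.

Let nm_ge0 u : 0 <= nm u.
Proof. by rewrite (le_trans _ (nm_ub u 0%N))// big_geq. Qed.

Let nmD u v : nm (u + v) <= nm u + nm v.
Proof.
by apply: nm_le => n; rewrite (le_trans (psumD _ _ n))// lerD ?nm_ub.
Qed.

Let nmZ_le a u : nm (a *: u) <= `|a| * nm u.
Proof. by apply: nm_le => n; rewrite [leLHS]psumZ ler_wpM2l ?nm_ub. Qed.

Let nm_pt (u : l1 R) n : `|u n| <= nm u.
Proof.
apply: le_trans (nm_ub u n.+1); rewrite big_nat_recr//= lerDr.
exact: sumr_ge0.
Qed.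

Let nm0 u : nm u = 0 -> u = 0.
Proof.
move=> u0; apply/val_inj/funext => n; apply/normr0_eq0/le_anti.
by rewrite normr_ge0 andbT -u0 nm_pt.
Qed.

Let nmZ a u : nm (a *: u) = `|a| * nm u.
Proof. exact: seminorm_homog nm_ge0 nmZ_le a u. Qed.

HB.instance Definition _ := @Lmodule_isNormed.Build R (l1 R) nm nmD nmZ nm0.

Lemma l1_psum_le (u : l1 R) n : \sum_(0 <= k < n) `|u k| <= `|u|.
Proof. exact: nm_ub. Qed.

Lemma l1_norm_le (u : l1 R) M :
  (forall n, \sum_(0 <= k < n) `|u k| <= M) -> `|u| <= M.
Proof. exact: nm_le. Qed.

Let ev (n : nat) (u : l1 R) : R^o := u n.

Let ev_linear n : linear (ev n). Proof. by []. Qed.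

HB.instance Definition _ n :=
  GRing.isLinear.Build R (l1 R) R^o *:%R (ev n) (ev_linear n).

Lemma l1_complete (F : set_system (l1 R)) :
  ProperFilter F -> cauchy F -> cvg F.
Proof.
apply: (@complete_ptws _ _ nat (fun n => ev n : {linear l1 R -> R^o})).
- by move=> n; exists 1 => // u; rewrite mul1r; exact: nm_pt.
- by move=> u u0; apply/val_inj/funext.
move=> {}F g u0 M FF Fg M0 FM.
have gM n : \sum_(0 <= k < n) `|g k - u0 k| <= M.
  have gn : (fun u => \sum_(0 <= k < n) `|ev k u - u0 k|) @ F -->
      \sum_(0 <= k < n) `|g k - u0 k|.
    apply: (@cvg_big R^o nat +%R 0) => [|k _]; first exact: add_continuous.
    by apply: cvg_norm; apply: cvgB; [exact: Fg|exact: cvg_cst].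
  rewrite -(cvg_lim _ gn)//; apply: limr_le.
    by apply/cvg_ex; eexists; exact: gn.
  by apply: filterS FM => u; apply: le_trans; exact: nm_ub (u - u0) n.
have gs : g \in summable_seq.
  apply/summable_seqP; exists (M + `|u0|) => n.
  rewrite (le_trans _ (lerD (gM n) (l1_psum_le u0 n)))// (le_trans _ (psumD _ _ n))//.
  by apply: ler_sum => k _; rewrite subrK.
by exists (L1 gs) => //; exact: nm_le.
Qed.

HB.instance Definition _ := Uniform_isComplete.Build (l1 R) l1_complete.

Lemma l1_basis_subproof (n : nat) :
  (fun k => (k == n)%:R : R) \in summable_seq.
Proof.
apply/summable_seqP; exists 1 => m; under eq_bigr do rewrite normr_nat.
rewrite -natr_sum lern1 (_ : \sum_(0 <= k < m) _ = (n < m))%N ?leq_b1//.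
elim: m => [|m IH]; first by rewrite big_geq.
rewrite big_nat_recr//= IH ltnS [in RHS]leq_eqVlt eq_sym.
by have [->|] := eqVneq n m; rewrite ?ltnn ?addn0.
Qed.

Definition l1_basis (n : nat) : l1 R := L1 (l1_basis_subproof n).

End l1.

Definition linear_subspace {R : realType} {W : lmodType R} (A : set W) :=
  A 0 /\ forall (a : R) x y, A x -> A y -> A (a *: x + y).

Definition lin_span {R : realType} {W : lmodType R} (A : set W) : set W :=
  smallest linear_subspace A.

Definition infinite_dimensional {R : realType} (W : lmodType R) :=
  forall s : seq W, lin_span [set` s] <> setT.

Definition two_dimensional_subspace {R : realType} {W : lmodType R}
    (L : set W) :=
  exists f g : W, (forall a b : R, a *: f + b *: g = 0 -> a = 0 /\ b = 0) /\
    L = [set h | exists a b : R, h = a *: f + b *: g].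

(* Meaningful for bounded T only: sup of an unbounded set of reals is 0 *)
Definition op_norm {R : realType} {E F : normedModType R} (T : E -> F) : R :=
  sup [set `|T x| | x in [set x | `|x| <= 1]].

Definition iso_embedding {R : realType} {E F : normedModType R}
    (T : {linear E -> F}) :=
  exists c C : R, [/\ 0 < c, 0 < C &
    forall x, c * `|x| <= `|T x| <= C * `|x|].

Definition isomorphism {R : realType} {E F : normedModType R}
    (T : {linear E -> F}) := iso_embedding T /\ range T = setT.

Definition contains_c0 {R : realType} (X : normedModType R) :=
  exists J : {linear c0 R -> X}, iso_embedding J.

Definition countable_norming_system {R : realType} {X : normedModType R}
    (xs : nat -> dual X) :=
  bounded_set (range xs) /\
  exists2 K : R, 0 <= K &
    forall x, `|x| <= K * sup (range (fun n => `|xs n x|)).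

Definition operator_range {R : realType} {V : completeNormedModType R}
    (Y : set V) :=
  exists (E : completeNormedModType R) (T : {linear E -> V}),
    [/\ infinite_dimensional E, continuous T, injective T & range T = Y].

Definition weak_star {R : realType} (V : normedModType R) : topologicalType :=
  initial_topology (fun f : dual V => (f : {ptws V -> R})).

Definition weak_star_dense {R : realType} {V : normedModType R}
    (Y : set (dual V)) := dense (Y : set (weak_star V)).

Definition separable_set {T : topologicalType} (A : set T) :=
  exists D : set T, [/\ countable D, D `<=` A & A `<=` closure D].

Definition modesty_witness {R : realType} {V : normedModType R}
    (Y Z : set (dual V)) :=
  [/\ separable_set Y, weak_star_dense Y, operator_range Y &
      Z `&` Y = [set 0]].

Definition weak_star_modest {R : realType} {V : normedModType R}
    (Z : set (dual V)) :=
  linear_subspace Z /\ exists Y, modesty_witness Y Z.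

(* For p an equivalent norm, (V, p) and V have the same continuous functionals;
   only the norm of a functional and the unit sphere depend on p. *)
Definition NA {R : realType} {V : normedModType R} (p : V -> R) :
    set (dual V) :=
  [set f | exists2 x, p x = 1 & dual_norm p f = `|f x|].

Definition equivalent_norm {R : realType} {V : normedModType R}
    (p : V -> R) :=
  [/\ forall x y, p (x + y) <= p x + p y,
      forall (a : R) x, p (a *: x) = `|a| * p x,
      forall x, p x = 0 -> x = 0
    & exists c C : R, [/\ 0 < c, 0 < C &
        forall x, c * `|x| <= p x <= C * `|x|]].

Definition read_norm {R : realType} {V : normedModType R} (p : V -> R) :=
  equivalent_norm p /\
  ~ (exists L : set (dual V), two_dimensional_subspace L /\ L `<=` NA p).

(* p is one of the norms |x| + |S x|_1, for some admissible T : l1 -> V^* and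
   weights r; S is determined by T and r. *)
Definition read_construction {R : realType} {V : normedModType R}
    (p : V -> R) :=
  exists (T : {linear l1 R -> dual V}) (r : nat -> R) (S : V -> l1 R),
  let Y := range T in
  let v n := T (l1_basis n) in
  [/\ [/\ continuous T, injective T & op_norm T = 1],
      modesty_witness Y (lin_span (NA (@Num.norm R V))),
      [set y | Y y /\ `|y| = 1] `<=` closure (range (fun n => `|v n|^-1 *: v n)),
      [/\ forall n, 0 < r n, cvgn (series r) &
          forall x n, S x n = r n * v n x]
    & p = (fun x => `|x| + `|S x|)].

(* Main.v *)
Require Import Defs.
From HB Require Import structures.
From mathcomp Require Import all_boot all_order all_algebra.
From mathcomp Require Import ring lra.
From mathcomp Require Import all_classical all_reals all_analysis.

Set Implicit Arguments.
Unset Strict Implicit.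
Unset Printing Implicit Defensive.

Import Order.TTheory GRing.Theory Num.Theory.
Import numFieldNormedType.Exports.

Local Open Scope classical_set_scope.
Local Open Scope ring_scope.

(* Extend the coordinates of a copy of c0 in X to functionals g_k (Hahn-Banach)
   and subtract from the norming functionals x_k^* the sums of their values on
   the basis (u_j) of c0 times g_j. Together these functionals G_n are norming,
   and each u_k is seen by a single G_n. Under the equivalent norm
   max(sup |G_n x|, 2 limsup |G_n x|), every point x of the unit ball can be
   moved by +-u_n/4 inside the ball for all large n, so a norm attaining
   functional vanishes at u_n for all large n, and so does every element of
   span(NA). On the other side one builds an injective operator A on l1 whose
   columns A e_n are, up to positive factors, dense in l1, while no nonzero A a
   vanishes at all large even coordinates; T sends a to the sum of (A a)_n G_n,
   so its range is weak-star dense and meets span(NA) only at 0.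

   For the Read property, Hahn-Banach on V x l1 writes a functional f attaining
   its p-norm at x as f0 + T s with f0 in NA(V) and |s_n| = p*(f) r_n whenever
   v_n(x) <> 0. Since T(l1) meets span(NA(V)) trivially, s is additive in f along
   a plane of NA(p). If p*(f) = p*(g) = 1, some n serves f, g, f + g and f - g
   simultaneously, as the directions of the v_n are dense in the range of T; then
   |s_n(f)| = |s_n(g)| makes s_n vanish at f + g or f - g, a contradiction. *)

(** * Hahn-Banach *)

Section hahn_banach.
Context {R : realType} {E F : lmodType R}.
Variables (j : {linear E -> F}) (f : {linear E -> R^o}) (p : F -> R).
Hypothesis p_subadd : forall x y, p (x + y) <= p x + p y.
Hypothesis p_homog : forall a x, 0 <= a -> p (a *: x) = a * p x.
Hypothesis f_le : forall e, f e <= p (j e).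

(** Partial functionals are encoded by their graphs, so extension is inclusion and Zorn's lemma
    applies to plain sets; single-valuedness follows from domination by [p]. *)
Let dominated (G : set (F * R^o)%type) :=
  [/\ linear_subspace G, forall x (a : R), G (x, a) -> a <= p x &
      forall e, G (j e, f e)].

Let dominated_fun G x (a b : R) : dominated G -> G (x, a) -> G (x, b) -> a <= b.
Proof.
move=> [[G0 GL] Gp _] Ga Gb.
have p00 : p 0 = 0 by rewrite -[0 in LHS](scale0r 0) p_homog// mul0r.
rewrite -subr_le0 -p00; apply: Gp.
have := GL (-1) _ _ Gb Ga; congr G; congr (_, _) => /=.
  by rewrite scaleN1r addNr.
by rewrite scaleN1r addrC.
Qed.

(** An admissible value at [x0] lies above every [a - p (x - x0)] and below every [p (y + x0) - b].
    Subadditivity orders the two families, and [c] is the supremum of the lower one. *)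
Let dominated_ext G x0 : dominated G ->
  exists2 G' : set (F * R^o)%type, dominated G' & G `<=` G' /\ exists a, G' (x0, a).
Proof.
move=> [[G0 GL] Gp Gf].
pose A := [set z.2 - p (z.1 - x0) | z in G].
have AB z z' : G z -> G z' -> z.2 - p (z.1 - x0) <= p (z'.1 + x0) - z'.2.
  case: z z' => [x a] [y b] Ga Gb /=.
  rewrite lerBlDr addrAC lerBrDr (le_trans (Gp (x + y) (a + b) _))//.
    by have := GL 1 _ _ Ga Gb; rewrite !scale1r.
  suff -> : x + y = (y + x0) + (x - x0) by exact: p_subadd.
  by rewrite addrACA subrr addr0 addrC.
pose c := sup A.
have Ac z : G z -> z.2 - p (z.1 - x0) <= c.
  move=> Gz; apply: (@sup_ub_le _ _ (p (0 + x0) - 0)); last by exists z.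
  by move=> _ [z' Gz' <-]; exact: (AB z' (0, 0)).
have cB z : G z -> c <= p (z.1 + x0) - z.2.
  move=> Gz; apply: ge_sup; first by exists (0 - p (0 - x0)); exists (0, 0).
  by move=> _ [z' Gz' <-]; exact: AB.
pose G' := [set z : F * R^o | exists t, G (z.1 - t *: x0, z.2 - t * c)].
have GZ t z : G z -> G (t *: z) by move=> Gz; have := GL t _ _ Gz G0; rewrite addr0.
exists G'.
  split=> [|x a [t /= Gt]|e]; last by exists 0; rewrite /= scale0r mul0r !subr0.
    split=> [|t [x a] [y b] [s /= Gs] [u /= Gu]].
      by exists 0; rewrite /= scale0r mul0r !subr0.
    exists (t * s + u) => /=; have := GL t _ _ Gs Gu; congr G.
    apply: injective_projections => /=.
      by rewrite scalerBr scalerDl opprD addrACA scalerA.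
    change (t * (a - s * c) + (b - u * c) = t * a + b - (t * s + u) * c).
    by rewrite mulrBr mulrDl opprD addrACA mulrA.
  (* Dividing by the modulus of [t] reduces the negative case to [Ac] and the positive one to
     [cB]. *)
  have [t0|t0|t0] := ltgtP t 0.
  - have s0 : 0 < - t by rewrite oppr_gt0.
    have := Ac _ (GZ (- t)^-1 _ Gt) => /=.
    rewrite /GRing.scale/= -(ler_pM2l s0) mulrBr mulrA divff ?gt_eqF// mul1r.
    rewrite -p_homog ?(ltW s0)// scalerBr scalerA divff ?gt_eqF// scale1r scaleNr opprK subrK.
    by rewrite mulNr lerBlDr -lerBlDl opprK subrK.
  - have := cB _ (GZ t^-1 _ Gt) => /=.
    rewrite /GRing.scale/= -(ler_pM2l t0) mulrBr mulrA divff ?gt_eqF// mul1r.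
    rewrite -p_homog ?(ltW t0)// scalerDr scalerA divff ?gt_eqF// scale1r subrK.
    by rewrite lerBrDl subrK.
  - by move: Gt; rewrite t0 scale0r mul0r !subr0; exact: Gp.
split=> [[x a] Ga|]; first by exists 0; rewrite /= scale0r mul0r !subr0.
by exists c, 1; rewrite /= scale1r mul1r !subrr.
Qed.

Theorem hahn_banach : exists g : {linear F -> R^o},
  (forall x, g x <= p x) /\ forall e, g (j e) = f e.
Proof.
pose G0 : set (F * R^o)%type := range (fun e => (j e, f e : R^o)).
have dom0 : dominated G0.
  split=> [|x a [e _ [<- <-]]|e]; [split|exact: f_le|by exists e].
    by exists 0; rewrite ?linear0.
  by move=> a _ _ [e _ <-] [e' _ <-]; exists (a *: e + e'); rewrite ?linearP.
pose P A := A = set0 \/ dominated A.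
have [|G [GP Gmax]] := @Zorn_bigcup _ P.
  move=> C CP Ctot.
  have [[A CA [z Az]]|C0] := pselect (exists2 A, C A & A !=set0); last first.
    left; rewrite -subset0 => z [A CA Az]; apply: C0; exists A => //; by exists z.
  have Cdom B x : C B -> B x -> dominated B.
    by move=> /CP[->|].
  have [[A0 _] _ Af] := Cdom _ _ CA Az.
  right; split=> [|x a [B CB Bxa]|e]; last by exists A.
    split=> [|a x y [B CB Bx] [B' CB' By]]; first by exists A.
    have [/(_ _ Bx) Bx'|/(_ _ By) By'] := Ctot _ _ CB CB'.
      by have [[_ H] _ _] := Cdom _ _ CB' By; exists B' => //; apply: H.
    by have [[_ H] _ _] := Cdom _ _ CB Bx; exists B => //; apply: H.
  by have [_ H _] := Cdom _ _ CB Bxa; exact: H.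
have domG : dominated G.
  case: GP => // G0'; exfalso; apply: (Gmax G0); last by right.
  rewrite G0'; split=> // sub0.
  by have := sub0 (j 0, f 0); apply; exists 0.
have Gtot x : exists a, G (x, a).
  have [G' domG' [GG' [a G'a]]] := dominated_ext x domG.
  exists a; apply: contrapT => nGa; apply: (Gmax G'); last by right.
  by split=> // /(_ _ G'a).
pose g x := xget 0 [set a : R^o | G (x, a)].
have Gg x : G (x, g x).
  by rewrite /g; case: xgetP => [a -> //|]; have [a Ga] := Gtot x => /(_ a).
have gE x a : G (x, a) -> g x = a.
  by move=> Ga; apply/le_anti/andP; split; apply: dominated_fun domG _ _; eauto.
have [[_ GL] Gp Gf] := domG.
have gl : linear (g : F -> R^o).
  by move=> a x y; apply: gE; exact: (GL a _ _ (Gg x) (Gg y)).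
exists (HB.pack g (GRing.isLinear.Build _ _ _ _ _ gl) : {linear F -> R^o}).
by split=> [x|e] /=; [exact: Gp|exact: gE].
Qed.

End hahn_banach.

(** * Bounded operators on l1 *)

Lemma bounded_linearP {R : realType} {E F : normedModType R}
    (T : {linear E -> F}) :
  continuous T <-> exists2 C, 0 <= C & forall x, `|T x| <= C * `|x|.
Proof.
split=> [/linear_bounded_continuous/linear_boundedP TC|[C C0 TC]].
  have : \forall r \near +oo, 0 <= r /\ forall x, `|T x| <= r * `|x|.
    by apply: filterS2 TC (nbhs_pinfty_ge (num_real 0)) => r.
  by move=> /filter_ex[r [r0 Tr]]; exists r.
apply/linear_bounded_continuous/linear_boundedP.
near=> N => x; apply: (le_trans (TC x)); apply: ler_wpM2r => //.
Unshelve. all: by end_near. Qed.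

Section l1_maps.
Context {R : realType}.
Implicit Types (u : l1 R) (E : normedModType R).

Lemma l1_basisE n k : l1_basis n k = (k == n)%:R :> R. Proof. by []. Qed.

Lemma l1_basis_norm_le1 n : `|l1_basis n : l1 R| <= 1.
Proof.
apply: l1_norm_le => N; under eq_bigr do rewrite l1_basisE.
have [nN|Nn] := ltnP n N.
  rewrite (bigD1_seq n) ?iota_uniq ?mem_index_iota//= eqxx normr1.
  by rewrite big1_seq ?addr0// => i /andP[/negPf -> _]; rewrite normr0.
rewrite big1_seq// => i; rewrite mem_index_iota => /= iN.
by rewrite ltn_eqF ?normr0// (leq_trans iN).
Qed.

Lemma l1_sumE (I : Type) (s : seq I) (f : I -> l1 R) k :
  (\sum_(i <- s) f i) k = \sum_(i <- s) f i k.
Proof. by elim/big_rec2: _ => // i x y _ <-. Qed.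

Lemma l1_sum_basis u N k :
  (\sum_(0 <= i < N) u i *: l1_basis i) k = if (k < N)%N then u k else 0.
Proof.
rewrite l1_sumE; have [kN|Nk] := ltnP k N.
  rewrite (bigD1_seq k) ?iota_uniq ?mem_index_iota//=.
  rewrite big1_seq => [|i /andP[ik _]].
    by rewrite addr0 [LHS](_ : _ = u k * (k == k)%:R)// eqxx mulr1.
  by rewrite [LHS](_ : _ = u i * (k == i)%:R)// eq_sym (negPf ik) mulr0.
rewrite big1_seq// => i /andP[_]; rewrite mem_index_iota => /andP[_ iN].
rewrite [LHS](_ : _ = u i * (k == i)%:R)//.
by rewrite gtn_eqF ?mulr0// (leq_trans iN).
Qed.

(** The additivity of the l1 norm over coordinates, in the form that later forces a norming
    functional to be extremal at every nonzero coordinate. *)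
Lemma l1_norm_sub_coord u n : `|u - u n *: l1_basis n| <= `|u| - `|u n|.
Proof.
apply: l1_norm_le => N; rewrite lerBrDr.
have E k : (u - u n *: l1_basis n) k = if k == n then 0 else u k.
  rewrite [LHS](_ : _ = u k - u n * (k == n)%:R)//.
  by case: eqVneq => [->|_]; rewrite ?mulr1 ?subrr ?mulr0 ?subr0.
(* Summing past [n] makes the deleted coordinate occur in the partial sum. *)
apply: le_trans (l1_psum_le u (maxn N n.+1)).
rewrite [leRHS](bigD1_seq n) ?iota_uniq ?mem_index_iota ?leq_max ?ltnSn ?orbT//=.
rewrite [leLHS]addrC lerD2l.
rewrite [leRHS](_ : _ = \sum_(0 <= k < maxn N n.+1) `|(u - u n *: l1_basis n) k|).
  rewrite [leRHS](@big_cat_nat _ _ _ N)//= ?leq_maxl// lerDl.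
  exact: sumr_ge0.
rewrite big_mkcond; apply: eq_bigr => k _.
by rewrite E; case: eqP => //=; rewrite normr0.
Qed.

Lemma l1_norm_cvg u : (fun n => \sum_(0 <= k < n) `|u k|) @ \oo --> `|u|.
Proof. by have := l1P u; rewrite inE. Qed.

Lemma l1_basis_cvg u :
  (fun N => \sum_(0 <= i < N) u i *: l1_basis i) @ \oo --> u.
Proof.
apply/cvgrPdist_le => e e0.
have /cvgrPdist_le/(_ _ e0) := @l1_norm_cvg u.
apply: filterS => N uN; apply: l1_norm_le => n.
have tail k : (u - \sum_(0 <= i < N) u i *: l1_basis i) k =
    if (k < N)%N then 0 else u k.
  rewrite [LHS](_ : _ = u k - (\sum_(0 <= i < N) u i *: l1_basis i) k)//.
  by rewrite l1_sum_basis; case: ifP; rewrite ?subrr ?subr0.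
under eq_bigr do rewrite tail.
have [nN|/ltnW Nn] := leqP n N.
  rewrite big1_seq ?ltW// => k; rewrite mem_index_iota => /= kn.
  by rewrite (leq_trans kn nN) normr0.
rewrite (@big_cat_nat _ _ _ N 0 n)//= big1_seq ?add0r => [|k]; last first.
  by rewrite mem_index_iota => /= kN; rewrite kN normr0.
rewrite (le_trans _ uN)// (le_trans _ (ler_norm _))// lerBrDl.
rewrite (le_trans _ (l1_psum_le u n))// (@big_cat_nat _ _ _ N 0 n)//= lerD2l.
by apply: ler_sum => k _; case: ifP; rewrite ?normr0.
Qed.

Lemma l1_map_cvg E (T : {linear l1 R -> E}) : continuous T -> forall u,
  (fun N => \sum_(0 <= i < N) u i *: T (l1_basis i)) @ \oo --> T u.
Proof.
move=> Tc u.
rewrite (_ : (fun _ => _) =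
  T \o (fun N => \sum_(0 <= i < N) u i *: l1_basis i)).
  exact: (cvg_comp _ _ (@l1_basis_cvg u) (Tc u)).
by apply/funext => N /=; rewrite linear_sum; under [RHS]eq_bigr do rewrite linearZ.
Qed.

(** Only basis vectors in the support of [u] enter its expansion. This refinement matters when the
    columns of [T] get smaller along the support. *)
Lemma l1_map_bound E (T : {linear l1 R -> E}) u B : continuous T -> 0 <= B ->
  (forall n, u n != 0 -> `|T (l1_basis n)| <= B) -> `|T u| <= B * `|u|.
Proof.
move=> Tc B0 TB.
have Tu : (fun N => `|\sum_(0 <= i < N) u i *: T (l1_basis i)|) @ \oo --> `|T u|.
  by apply: cvg_norm; exact: l1_map_cvg.
rewrite -(cvg_lim _ Tu)//; apply: limr_le; first by apply/cvg_ex; eexists; exact: Tu.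
apply: nearW => N; rewrite (le_trans (ler_norm_sum _ _ _))//.
rewrite (@le_trans _ _ (\sum_(0 <= i < N) B * `|u i|))//.
  apply: ler_sum => i _; rewrite normrZ mulrC.
  by have [->|/TB] := eqVneq (u i) 0; [rewrite normr0 !mulr0|exact: ler_wpM2r].
by rewrite -mulr_sumr ler_wpM2l// l1_psum_le.
Qed.

(** The universal property of l1: the series of [u i *: v i] converges absolutely. *)
Lemma l1_map_ext (E : completeNormedModType R) (v : nat -> E) C :
  (forall n, `|v n| <= C) ->
  exists T : {linear l1 R -> E}, continuous T /\ forall n, T (l1_basis n) = v n.
Proof.
move=> vC.
have C0 : 0 <= C by rewrite (le_trans _ (vC 0%N)).
have bnd u N : \sum_(0 <= i < N) `|u i *: v i| <= C * `|u|.
  rewrite (@le_trans _ _ (\sum_(0 <= i < N) C * `|u i|))//.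
    by apply: ler_sum => i _; rewrite normrZ mulrC ler_wpM2r.
  by rewrite -mulr_sumr ler_wpM2l// l1_psum_le.
pose s u := series (fun i => u i *: v i).
have sc u : cvgn (s u).
  apply: normed_cvg; apply: nondecreasing_is_cvgn.
    by apply: nondecreasing_series => i _ _; exact: normr_ge0.
  by exists (C * `|u|) => _ [N _ <-]; exact: bnd.
pose g u := limn (s u).
have gl : linear g.
  move=> a x y; apply: cvg_lim; first exact: norm_hausdorff.
  rewrite (_ : s _ = (fun N => a *: s x N + s y N)).
    by apply: cvgD; [apply: cvgZr; exact: sc|exact: sc].
  apply/funext => N; rewrite /s /series/= scaler_sumr -big_split/=.
  by apply: eq_bigr => i _; rewrite scalerA -scalerDl.
pose T : {linear l1 R -> E} := HB.pack g (GRing.isLinear.Build _ _ _ _ _ gl).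
exists T; split=> [|n] /=.
  apply/(bounded_linearP T); exists C => // u; change (`|g u| <= C * `|u|).
  have gu : (fun N => `|s u N|) @ \oo --> `|g u| by apply: cvg_norm; exact: sc.
  rewrite -(cvg_lim _ gu)//; apply: limr_le; first by apply/cvg_ex; eexists; exact: gu.
  by apply: nearW => N; rewrite (le_trans _ (bnd u N))// ler_norm_sum.
apply: cvg_lim; first exact: norm_hausdorff.
apply: cvg_near_cst; exists n.+1 => // N /= nN.
rewrite /s /series/= (bigD1_seq n) ?iota_uniq ?mem_index_iota//=.
rewrite big1_seq => [|i /andP[ik _]]; first by rewrite addr0 eqxx scale1r.
by rewrite (negPf ik) scale0r.
Qed.

End l1_maps.

(** * Weak-star density *)

Section weak_star_density.
Context {R : realType} {V : normedModType R}.
Implicit Types (f g : dual V) (Y : set (dual V)).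

Lemma dual_lin a f g x : (a *: f + g) x = a * f x + g x. Proof. by []. Qed.

Lemma dual_of_linear (g : {linear V -> R^o}) C :
  (forall x, g x <= C * `|x|) -> exists f : dual V, f =1 g :> (V -> R).
Proof.
move=> gC.
have gd : (g : V -> R) \in cont_functional.
  rewrite inE; have gl : linear g by move=> a x y; exact: linearP.
  split=> //; apply/(cont_functional_bounded gl); exists C => x.
  rewrite ler_norml gC andbT lerNl.
  by have := gC (- x); rewrite linearN normrN.
by exists (Dual gd).
Qed.

Lemma norming_functional (x : V) : exists f : dual V, f x = `|x|.
Proof.
pose j (a : R^o) : V := a *: x.
have jl : linear j by move=> a b c; rewrite /j scalerDl scalerA.
pose J : {linear R^o -> V} := HB.pack j (GRing.isLinear.Build _ _ _ _ _ jl).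
pose h (a : R^o) : R^o := a * `|x|.
have hl : linear h.
  move=> a b c; change ((a * b + c) * `|x| = a * (b * `|x|) + c * `|x|).
  by rewrite mulrDl mulrA.
pose H : {linear R^o -> R^o} := HB.pack h (GRing.isLinear.Build _ _ _ _ _ hl).
have [||e|g [g1 gj]] := @hahn_banach _ _ _ J H Num.norm.
- exact: ler_normD.
- by move=> a y a0; rewrite normrZ ger0_norm.
- by rewrite /H /J /= /h /j normrZ ler_wpM2r// ler_norm.
have [f fg] : exists f : dual V, f =1 g :> (V -> R).
  by apply: (@dual_of_linear g 1) => y; rewrite mul1r.
exists f; rewrite fg; have := gj (1 : R^o).
by rewrite /J /H /= /j /h scale1r mul1r.
Qed.

(** For nonzero [x], the functionals not vanishing at [x] form a weak-star open set, nonempty by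
    [norming_functional], which [Y] would miss. *)
Lemma weak_star_dense_total Y x :
  weak_star_dense Y -> (forall y, Y y -> y x = 0) -> x = 0.
Proof.
move=> Yd Yx; apply: contrapT => /eqP x0.
have [f fx] := norming_functional x.
have [||g [/eqP gx /Yx]//] := Yd [set g : weak_star V | (g : dual V) x != 0].
  by exists f; rewrite /= fx normr_eq0.
have /continuousP evc : continuous (fun h : {ptws V -> R} => h x).
  exact: (@proj_continuous V (fun=> R) x).
exists [set h : {ptws V -> R} | h x != 0] => //.
have -> : [set h : {ptws V -> R} | h x != 0] =
  (fun h : {ptws V -> R} => h x) @^-1` (~` [set 0]) by apply/seteqP; split => h /= /eqP.
apply: evc; rewrite openC; exact: closed_eq.
Qed.

(** Induction on [s]. If [Y] vanishes at [x], so does [f], and [x] imposes nothing; otherwise [f] is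
    corrected at [x] by a multiple of some [y0] with [y0 x = 1], and the rest is interpolated inside
    the elements of [Y] vanishing at [x]. *)
Lemma interpolation Y f (s : seq V) : linear_subspace Y ->
  (forall z, (forall y, Y y -> y z = 0) -> f z = 0) ->
  exists2 y, Y y & forall x, x \in s -> y x = f x.
Proof.
elim: s Y f => [|x s IH] Y f [Y0 YL] Yf; first by exists 0.
have [Yx|] := pselect (forall y, Y y -> y x = 0).
  have [y Yy ys] := IH Y f (conj Y0 YL) Yf.
  exists y => // z; rewrite inE => /orP[/eqP ->|/ys//].
  by rewrite (Yx _ Yy) (Yf _ Yx).
move=> /existsNP[y1 /not_implyP[Yy1 /eqP y1x]].
pose y0 := (y1 x)^-1 *: y1.
have YZ a y : Y y -> Y (a *: y) by move=> Yy; have := YL a _ _ Yy Y0; rewrite addr0.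
have Yy0 : Y y0 by exact: YZ.
have y0x : y0 x = 1 by rewrite [LHS](_ : _ = (y1 x)^-1 * y1 x)// mulVf.
have [||y [Yy yx] ys] := IH [set y | Y y /\ y x = 0] (- f x *: y0 + f).
- split=> [|a y y' [Yy yx] [Yy' yx']]; first by [].
  by split; [exact: YL|rewrite dual_lin yx yx' mulr0 addr0].
(* Each [y - y x *: y0] lies in the smaller space, so [y z = y x * y0 z]; hence [z - y0 z *: x] is a
   common zero of [Y], and of [f]. *)
- move=> z zY'.
  have fz : f (z - y0 z *: x) = 0.
    apply: Yf => y Yy; have yz0 : - y x * y0 z + y z = 0.
      apply: (zY' (- y x *: y0 + y)); split; first exact: YL.
      by change (- y x * y0 x + y x = 0); rewrite y0x mulr1 addNr.
    by rewrite linearB linearZ/= -[RHS]yz0 addrC mulNr [y x * _]mulrC.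
  change (- f x * y0 z + f z = 0).
  by rewrite -[RHS]fz linearB linearZ/= addrC mulNr [f x * _]mulrC.
exists (f x *: y0 + y) => [|z]; first exact: YL.
change (z \in x :: s -> f x * y0 z + y z = f z).
rewrite inE => /orP[/eqP ->|/ys ->]; first by rewrite y0x yx mulr1 addr0.
by change (f x * y0 z + (- f x * y0 z + f z) = f z); rewrite mulNr addNKr.
Qed.

(** The elements of [Y] that agree with [f] on a finite set, as the set varies, generate a filter
    converging pointwise to [f]. *)
Lemma total_weak_star_dense Y : linear_subspace Y ->
  (forall x, (forall y, Y y -> y x = 0) -> x = 0) -> weak_star_dense Y.
Proof.
move=> YL Ytot O [f Of] [A oA AO].
have interp (s : seq V) : exists2 y, Y y & forall x, x \in s -> y x = (f : dual V) x.
  apply: (@interpolation Y f s YL) => z /Ytot ->.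
  exact: (linear0 (f : dual V)).
pose B (s : seq V) : set {ptws V -> R} :=
  [set (y : V -> R) | y in [set y | Y y /\ forall x, x \in s -> y x = f x]].
have FB : Filter (filter_from setT B).
  apply: filter_from_filter; first by exists [::].
  move=> s t _ _; exists (s ++ t) => // _ [y [Yy yst] <-].
  by split; exists y => //; split=> // x xs; apply: yst; rewrite mem_cat xs ?orbT.
have : {ptws, filter_from setT B --> (f : V -> R)}.
  apply/pointwise_cvgP => x; apply: cvg_near_cst.
  by exists [:: x] => // _ [y [_ yx] <-]; apply: yx; rewrite inE.
have /[swap]/[apply] : nbhs (f : {ptws V -> R}) A.
  by apply: open_nbhs_nbhs; split=> //; move: Of; rewrite -AO.
move=> [s _ BsA]; have [y Yy ys] := interp s.
exists y; split=> //; rewrite -AO; apply: BsA.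
by exists y.
Qed.

End weak_star_density.

(** Bundling evaluation at [x] as a scalar functional on l1 allows [l1_map_bound] and [l1_map_cvg]
    to be used pointwise, with bounds depending on [x]. *)
Lemma l1_map_eval {R : realType} {V : normedModType R}
    (T : {linear l1 R -> dual V}) (x : V) : continuous T ->
  exists E : {linear l1 R -> R^o}, continuous E /\ forall a, E a = T a x.
Proof.
move=> /(bounded_linearP T)[C C0 TC].
pose e (a : l1 R) : R^o := T a x.
have el : linear e by move=> t a b; rewrite /e linearP.
pose E : {linear l1 R -> R^o} := HB.pack e (GRing.isLinear.Build _ _ _ _ _ el).
exists E; split=> //; apply/(bounded_linearP E); exists (C * `|x|) => [|a].
  by rewrite mulr_ge0.
by rewrite (le_trans (ler_dual (T a) x))// mulrAC ler_wpM2r.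
Qed.

(** * Equivalent norms and norm attainment *)

Section subspaces.
Context {R : realType} {W : lmodType R}.
Implicit Types A B : set W.

Lemma linear_subspaceZ A (a : R) x : linear_subspace A -> A x -> A (a *: x).
Proof. by move=> [A0 AL] Ax; have := AL a _ _ Ax A0; rewrite addr0. Qed.

Lemma linear_subspaceD A x y : linear_subspace A -> A x -> A y -> A (x + y).
Proof. by move=> [A0 AL] Ax Ay; have := AL 1 _ _ Ax Ay; rewrite scale1r. Qed.

Lemma linear_subspaceB A x y : linear_subspace A -> A x -> A y -> A (x - y).
Proof. by move=> [A0 AL] Ax Ay; have := AL (-1) _ _ Ay Ax; rewrite scaleN1r addrC. Qed.

Lemma lin_span_subspace A : linear_subspace (lin_span A).
Proof.
split=> [B [[B0 _] _] //|a x y Ax Ay B BA].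
by case: (BA) => [[_ BL] _]; apply: BL; [exact: Ax|exact: Ay].
Qed.

Lemma sub_lin_span A : A `<=` lin_span A.
Proof. by move=> x Ax B [_]; apply. Qed.

Lemma lin_span_sub A B : linear_subspace B -> A `<=` B -> lin_span A `<=` B.
Proof. by move=> BL AB x; apply. Qed.

End subspaces.

Lemma range_subspace {R : realType} {E F : lmodType R} (T : {linear E -> F}) :
  linear_subspace (range T).
Proof.
split=> [|a _ _ [x _ <-] [y _ <-]]; first by exists 0; rewrite ?linear0.
by exists (a *: x + y); rewrite ?linearP.
Qed.

Section equivalent_norms.
Context {R : realType} {V : normedModType R} (p : V -> R).
Hypothesis pN : equivalent_norm p.

Lemma equivalent_norm_ge0 x : 0 <= p x.
Proof.
have [_ _ _ [c [C [c0 _ /(_ x)/andP[cx _]]]]] := pN.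
by apply: le_trans cx; rewrite mulr_ge0// ltW.
Qed.

Lemma dual_norm_equiv_ub (f : dual V) y : p y <= 1 -> `|f y| <= dual_norm p f.
Proof.
have [_ _ _ [c [C [c0 _ pc]]]] := pN.
move=> py; apply: (@sup_ub_le _ _ (`|f| / c)); last by exists y.
move=> _ [z pz <-]; rewrite (le_trans (ler_dual _ _))// ler_wpM2l//.
have /andP[cz _] := pc z.
by rewrite -[c^-1]mul1r ler_pdivlMr// mulrC (le_trans cz).
Qed.

Lemma dual_norm_equiv_bound (f : dual V) x : `|f x| <= dual_norm p f * p x.
Proof.
have [_ pZ p0 _] := pN.
have [px0|px0] := eqVneq (p x) 0.
  by rewrite (p0 _ px0) linear0 normr0 -(p0 _ px0) px0 mulr0.
have px : 0 < p x by rewrite lt_neqAle eq_sym px0 equivalent_norm_ge0.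
rewrite -ler_pdivrMr//; have := @dual_norm_equiv_ub f ((p x)^-1 *: x).
rewrite pZ ger0_norm ?invr_ge0 ?(ltW px)// mulVf// => /(_ (lexx _)).
by rewrite linearZ/= normrM ger0_norm ?invr_ge0 ?(ltW px)// mulrC.
Qed.

Lemma dual_norm_equiv_ge0 (f : dual V) : 0 <= dual_norm p f.
Proof.
have [_ pZ _ _] := pN.
have := @dual_norm_equiv_ub f 0.
by rewrite -(scale0r (0 : V)) pZ normr0 mul0r => /(_ ler01); apply: le_trans.
Qed.

Lemma dual_norm_equiv_eq0 (f : dual V) : dual_norm p f = 0 -> f = 0.
Proof.
move=> f0; apply/val_inj/funext => x; apply/normr0_eq0/le_anti.
by rewrite normr_ge0 andbT (le_trans (dual_norm_equiv_bound f x))// f0 mul0r.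
Qed.

Lemma dual_norm_equivZ a (f : dual V) :
  dual_norm p (a *: f) = `|a| * dual_norm p f.
Proof.
have le b (g : dual V) : dual_norm p (b *: g) <= `|b| * dual_norm p g.
  apply: sup_le_ub0 => [|_ [x px <-]]; first by rewrite mulr_ge0// dual_norm_equiv_ge0.
  rewrite [leLHS](_ : _ = `|b| * `|g x|) ?ler_wpM2l//; last by rewrite -normrM.
  rewrite (le_trans (dual_norm_equiv_bound g x))// -[leRHS]mulr1.
  by rewrite ler_wpM2l// dual_norm_equiv_ge0.
exact: (@seminorm_homog _ (dual V) (fun g => dual_norm p g)
  dual_norm_equiv_ge0 le).
Qed.

Lemma NA_attained (f : dual V) :
  NA p f -> exists2 x, p x = 1 & f x = dual_norm p f.
Proof.
have [_ pZ _ _] := pN.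
move=> [x px ->]; have [fx|/ltW fx] := leP 0 (f x); first by exists x; rewrite ?ger0_norm.
exists (- x); last by rewrite linearN ler0_norm.
by rewrite -scaleN1r pZ normrN normr1 mul1r.
Qed.

End equivalent_norms.

(** Nonvanishing at finitely many points is an open condition, so one norm-one element of [Y]
    satisfying it suffices: a nearby normalized [v n] inherits it. *)
Lemma common_nonvanishing {R : realType} {V : normedModType R}
    (Y : set (dual V)) (v : nat -> dual V) (s : seq V) :
  linear_subspace Y -> (forall x, (forall y, Y y -> y x = 0) -> x = 0) ->
  [set y | Y y /\ `|y| = 1] `<=` closure (range (fun n => `|v n|^-1 *: v n)) ->
  0 \notin s -> exists n, forall x, x \in s -> v n x != 0.
Proof.
move=> YL Ytot Yv s0.
(* A point of [s] is what guarantees that the chosen [y] is nonzero and can be normalized. *)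
have [->|[x1 x1s]] : s = [::] \/ exists x1, x1 \in s.
- by case: (s) => [|x1 ?]; [left|right; exists x1; rewrite inE eqxx].
- by exists 0%N.
have [y Yy ys] : exists2 y, Y y & forall x, x \in s -> y x != 0.
  elim: s s0 {x1s} => [|x s IH]; first by exists 0 => //; case: YL.
  rewrite inE negb_or eq_sym => /andP[x0 /IH[y Yy ys]].
  have [z Yz zx] : exists2 z, Y z & z x != 0.
    apply: contrapT => nz; move/eqP: x0; apply; apply: Ytot => z Yz.
    by apply: contrapT => /eqP zx; apply: nz; exists z.
  (* t exceeds every |y w| / |z w|, so y + t z vanishes only where z does *)
  pose t := 1 + \sum_(w <- x :: s) `|y w| / `|z w|.
  have tz w : w \in x :: s -> z w != 0 -> `|y w| < t * `|z w|.
    move=> ws zw; rewrite -ltr_pdivrMr ?normr_gt0//.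
    rewrite /t (big_rem _ ws)/= addrA [1 + _]addrC -addrA ltrDl.
    by rewrite ltr_pwDl// sumr_ge0// => i _; rewrite divr_ge0.
  have t0 : 0 <= t by rewrite addr_ge0// sumr_ge0// => i _; rewrite divr_ge0.
  exists (t *: z + y) => [|w ws]; first by case: YL => _; apply.
  change (t * z w + y w != 0).
  have [zw|zw] := eqVneq (z w) 0.
    rewrite zw mulr0 add0r; apply: ys; move: ws; rewrite inE => /orP[/eqP wx|//].
    by move: zx; rewrite -wx zw eqxx.
  rewrite addr_eq0; apply: contraTneq (tz _ ws zw) => tzy.
  by rewrite -leNgt -[X in X * _](ger0_norm t0) -normrM tzy normrN.
have y0 : `|y| != 0.
  by rewrite normr_eq0; apply: contra_neq (ys _ x1s) => ->.
pose y1 := `|y|^-1 *: y.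
have y1s x : x \in s -> y1 x != 0.
  move=> /ys yx; change (`|y|^-1 * y x != 0).
  by rewrite mulf_neq0// invr_eq0.
have /Yv y1c : Y y1 /\ `|y1| = 1.
  by split; [exact: linear_subspaceZ|rewrite normrZ normfV normr_id mulVf].
have : nbhs y1 [set g : dual V | forall x, x \in s -> g x != 0].
  elim: s y1s {x1s s0 ys} => [|x s IH] y1s.
    by apply: filterS filterT.
  have /IH ns : forall w, w \in s -> y1 w != 0.
    by move=> w ws; apply: y1s; rewrite inE ws orbT.
  have nx : nbhs y1 [set g : dual V | g x != 0].
    have y1x : y1 x != 0 by apply: y1s; rewrite inE eqxx.
    have e0 : 0 < `|y1 x| / (`|x| + 1) by rewrite divr_gt0 ?normr_gt0// ltr_wpDl.
    apply/nbhs_normP; exists (`|y1 x| / (`|x| + 1)) => //= g /= gy.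
    apply/eqP => gx; move: gy; apply/negP; rewrite -leNgt ler_pdivrMr ?ltr_wpDl//.
    have := ler_dual (y1 - g) x.
    rewrite [X in `|X|](_ : _ = y1 x - g x)// gx subr0 => /le_trans; apply.
    by rewrite ler_wpM2l// lerDl.
  apply: filterS2 nx ns => g gx gs w.
  by rewrite inE => /orP[/eqP ->|/gs].
move=> /y1c[_ [[n _ <-] vn]]; exists n => x /vn.
by apply: contra_neq => vx; rewrite [LHS](_ : _ = `|v n|^-1 * v n x)// vx mulr0.
Qed.

(** * The Read property of the constructed norms and its transport along isomorphisms *)

Section read_norms.
Context {R : realType} {V : normedModType R}.
Variables (T : {linear l1 R -> dual V}) (r : nat -> R) (S : V -> l1 R).
Let v n := T (l1_basis n).
Let p x := `|x| + `|S x|.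
Hypothesis T_cont : continuous T.
Hypotheses (r_gt0 : forall n, 0 < r n) (r_sum : cvgn (series r)).
Hypothesis SE : forall x n, S x n = r n * v n x.

Let S_linear : linear S.
Proof.
move=> a x y; apply/val_inj/funext => n.
rewrite [LHS](SE (a *: x + y) n) linearP/=.
rewrite [RHS](_ : _ = a * S x n + S y n)// !SE.
by rewrite mulrDr mulrCA.
Qed.

Let Sl : {linear V -> l1 R} := HB.pack S (GRing.isLinear.Build _ _ _ _ _ S_linear).

Lemma summed_norm_equivalent : equivalent_norm p.
Proof.
have [C C0 TC] := (bounded_linearP T).1 T_cont.
have vC n : `|v n| <= C by rewrite (le_trans (TC _))// ler_piMr// l1_basis_norm_le1.
pose M := limn (series r).
have rM N : \sum_(0 <= k < N) r k <= M.
  apply: (nondecreasing_cvgn_le _ r_sum).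
  by apply: nondecreasing_series => k _ _; exact: ltW.
have M0 : 0 <= M by have := rM 0%N; rewrite big_geq.
have SM x : `|Sl x| <= M * C * `|x|.
  apply: l1_norm_le => N.
  rewrite (@le_trans _ _ (\sum_(0 <= k < N) r k * (C * `|x|)))//.
    apply: ler_sum => k _; rewrite [X in `|X|](SE x k) normrM gtr0_norm//.
    apply: ler_wpM2l; first exact: ltW.
    by rewrite (le_trans (ler_dual _ _))// ler_wpM2r.
  by rewrite -mulr_suml -mulrA ler_wpM2r// mulr_ge0.
rewrite /p -[S]/(Sl : V -> l1 R); split=> [x y|a x|x|].
- by rewrite linearD addrACA lerD// ler_normD.
- by rewrite linearZ/= !normrZ mulrDr.
- by move=> /eqP; rewrite paddr_eq0// normr_eq0 => /andP[/eqP].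
- exists 1, (1 + M * C); split=> [//||x]; first by rewrite ltr_pwDl// mulr_ge0.
  by rewrite mul1r lerDl normr_ge0/= mulrDl mul1r lerD2l SM.
Qed.

(** The map [z |-> (z, S z)] is isometric from [p] into the l1-sum of [V] and l1, where [f] extends
    to a pair [(g1, phi)] with both parts bounded by [L]. Attainment at [x] makes both bounds
    equalities at [x] and [S x]. *)
Lemma NA_summed_decomposition (f : dual V) : NA p f ->
  exists x f0 s, [/\ x != 0, lin_span (NA (@Num.norm R V)) f0, f = f0 + T s &
    forall n, v n x != 0 -> `|s n| = dual_norm p f * r n].
Proof.
have pN := summed_norm_equivalent.
move=> /(NA_attained pN)[x px fx].
have L0 : 0 <= dual_norm p f by exact: dual_norm_equiv_ge0.
have fL z : f z <= dual_norm p f * p z.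
  by rewrite (le_trans (ler_norm _))// dual_norm_equiv_bound.
set L := dual_norm p f in fx L0 fL *.
have x0 : x != 0.
  apply/eqP => x0; move: px; rewrite x0 /p -[S]/(Sl : V -> l1 R) linear0 !normr0.
  by rewrite addr0 => /eqP; rewrite eq_sym oner_eq0.
have nx0 : 0 < `|x| by rewrite normr_gt0.
pose j z : (V * l1 R)%type := (z, Sl z).
have jl : linear j.
  by move=> a y z; apply: injective_projections => //=; exact: S_linear.
pose J : {linear V -> (V * l1 R)%type} := HB.pack j (GRing.isLinear.Build _ _ _ _ _ jl).
(* The dominating function is the scaled sum of the two norms, not the max norm of the product. *)
have [||e|g [gL gj]] := @hahn_banach _ _ _ J (f : {linear V -> R^o})
    (fun w => L * (`|w.1| + `|w.2|)).
- move=> a b /=; rewrite -mulrDr ler_wpM2l// addrACA lerD//; exact: ler_normD.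
- by move=> a b a0 /=; rewrite !normrZ ger0_norm// -mulrDr mulrCA.
- exact: fL.
pose i0 z : (V * l1 R)%type := (z, 0).
pose k0 u : (V * l1 R)%type := (0, u).
have il : linear i0.
  by move=> a y z; apply: injective_projections => //=; rewrite scaler0 addr0.
have kl : linear k0.
  by move=> a y z; apply: injective_projections => //=; rewrite scaler0 addr0.
pose i : {linear V -> (V * l1 R)%type} := HB.pack i0 (GRing.isLinear.Build _ _ _ _ _ il).
pose k : {linear l1 R -> (V * l1 R)%type} := HB.pack k0 (GRing.isLinear.Build _ _ _ _ _ kl).
pose g1 : {linear V -> R^o} := g \o i.
pose phi : {linear l1 R -> R^o} := g \o k.
have g1L z : g1 z <= L * `|z| by have := gL (i z); rewrite /= normr0 addr0.
have phiL u : phi u <= L * `|u| by have := gL (k u); rewrite /= normr0 add0r.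
have fE z : f z = g1 z + phi (S z).
  rewrite -(gj z) /g1 /phi /= -linearD; congr (g _).
  by apply: injective_projections; rewrite /= ?addr0 ?add0r.
have phiLn u : `|phi u| <= L * `|u|.
  by rewrite ler_norml phiL andbT lerNl -linearN -[`|u|]normrN phiL.
have phic : continuous phi by apply/bounded_linearP; exists L.
have [f0 f0E] := @dual_of_linear _ _ g1 L g1L.
have eqx : g1 x = L * `|x| /\ phi (S x) = L * `|S x|.
  have fxE : g1 x + phi (S x) = L * `|x| + L * `|S x|.
    by rewrite -fE fx -mulrDr -/(p x) px mulr1.
  by have := g1L x; have := phiL (S x); split; lra.
have e1 n : `|phi (l1_basis n)| <= L.
  by rewrite (le_trans (phiLn _))// ler_piMr// l1_basis_norm_le1.
(* This choice gives [T s = phi \o S]: both expand into the series of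
   [r n * v n z * phi (l1_basis n)]. *)
have ss : (fun n => r n * phi (l1_basis n) : R) \in summable_seq.
  apply/summable_seqP; exists (limn (series r) * L) => N.
  rewrite (@le_trans _ _ (\sum_(0 <= n < N) r n * L))//.
    by apply: ler_sum => n _; rewrite normrM gtr0_norm// ler_wpM2l// ltW.
  rewrite -mulr_suml ler_wpM2r//.
  apply: (nondecreasing_cvgn_le _ r_sum).
  by apply: nondecreasing_series => n _ _; exact: ltW.
pose s := L1 ss.
have TsE z : T s z = phi (S z).
  have [Tz [Tzc TzE]] := l1_map_eval z T_cont.
  rewrite -TzE.
  have := @l1_map_cvg _ _ _ Tzc s; have := @l1_map_cvg _ _ _ phic (S z).
  rewrite (_ : (fun N => _) = (fun N => \sum_(0 <= n < N) s n *: Tz (l1_basis n))).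
    by move=> c1 c2; apply: (cvg_unique (@norm_hausdorff _ R^o) c2 c1).
  apply/funext => N; apply: eq_bigr => n _; rewrite SE TzE.
  change (r n * v n z * phi (l1_basis n) = r n * phi (l1_basis n) * v n z).
  by rewrite mulrAC.
exists x, f0, s; split=> //.
- apply: sub_lin_span; exists (`|x|^-1 *: x).
    by rewrite normrZ normfV normr_id mulVf// gt_eqF.
  have f0x : f0 (`|x|^-1 *: x) = L.
    rewrite linearZ/= f0E eqx.1; change (`|x|^-1 * (L * `|x|) = L).
    by rewrite mulrCA mulVf ?mulr1// gt_eqF.
  apply/le_anti/andP; split; last first.
    by apply: dual_norm_ub; rewrite normrZ normfV normr_id mulVf// gt_eqF.
  rewrite f0x ger0_norm//; apply: dual_norm_le => // z z1.
  rewrite (@le_trans _ _ (L * `|z|))//; last by rewrite ler_piMr.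
  by rewrite f0E ler_norml g1L andbT lerNl -linearN -[`|z|]normrN g1L.
- apply/val_inj/funext => z.
  by rewrite [RHS](_ : _ = f0 z + T s z)// TsE f0E; exact: fE.
- move=> n vnx; rewrite [X in `|X|](_ : _ = r n * phi (l1_basis n))//.
  rewrite normrM gtr0_norm// mulrC; congr (_ * _).
  apply/le_anti; rewrite e1/=.
  have Sn : 0 < `|S x n| by rewrite SE normr_gt0 mulf_neq0// gt_eqF.
  (* Without coordinate [n], [phi] is at most [L] times a norm smaller by the modulus of [S x n];
     that coordinate must therefore contribute at least [L] times this modulus. *)
  have := phiL (S x - S x n *: l1_basis n).
  rewrite [phi _](_ : _ = L * `|S x| - S x n * phi (l1_basis n)) => [h|]; last first.
    by rewrite -eqx.2 linearB linearZ.
  have h' := ler_wpM2l L0 (l1_norm_sub_coord (S x) n).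
  have : L * `|S x n| <= S x n * phi (l1_basis n).
    by have := le_trans h h'; rewrite mulrBr lerD2l lerN2.
  move=> /le_trans/(_ (ler_norm _)); rewrite normrM mulrC.
  by rewrite ler_pM2l.
Qed.

End read_norms.

Lemma read_construction_read_norm {R : realType} {V : normedModType R}
    (p : V -> R) : read_construction p -> read_norm p.
Proof.
move=> [T [r [S [[Tc Tinj _] [_ Yd _ ZY] Yv [r0 rc SE] pE]]]].
have := summed_norm_equivalent Tc r0 rc SE.
have := NA_summed_decomposition Tc r0 rc SE.
rewrite -pE => dec pN {pE}; split=> //.
move=> [L [[f [g [ind ->]]] LNA]].
have NAc a b : NA p (a *: f + b *: g) by apply: LNA; exists a, b.
have pos (h : dual V) : h <> 0 -> 0 < dual_norm p h.
  move=> h0; rewrite lt_neqAle dual_norm_equiv_ge0// andbT eq_sym.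
  by apply/eqP => /(dual_norm_equiv_eq0 pN).
have nz a b : a != 0 \/ b != 0 -> a *: f + b *: g <> 0.
  by move=> ab /ind[a0 b0]; move: ab; rewrite a0 b0 eqxx => -[].
have lf : 0 < dual_norm p f.
  apply: pos => f0; have := nz 1 0; rewrite scale1r scale0r addr0; apply=> //.
  by left; rewrite oner_eq0.
have lg : 0 < dual_norm p g.
  apply: pos => g0; have := nz 0 1; rewrite scale1r scale0r add0r; apply=> //.
  by right; rewrite oner_eq0.
(* With dual norm 1 on both sides, [s1 n] and [s2 n] have the same modulus [r n] wherever [v n] is
   nonzero at [x1] and [x2]. *)
pose a := (dual_norm p f)^-1; pose b := (dual_norm p g)^-1.
have a0 : 0 < a by rewrite invr_gt0.
have b0 : 0 < b by rewrite invr_gt0.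

have [|x1 [f1 [s1 [x10 f1Z E1 s1n]]]] := dec (a *: f).
- by have := NAc a 0; rewrite scale0r addr0.
have [|x2 [f2 [s2 [x20 f2Z E2 s2n]]]] := dec (b *: g).
- by have := NAc 0 b; rewrite scale0r add0r.
have [|x3 [f3 [s3 [x30 f3Z E3 s3n]]]] := dec (a *: f + b *: g) => //.
have [|x4 [f4 [s4 [x40 f4Z E4 s4n]]]] := dec (a *: f - b *: g).
- by have := NAc a (- b); rewrite scaleNr.
have ZL := @lin_span_subspace _ _ (NA (@Num.norm R V)).
(* Applied to [f1 + f2 - f3] and [f1 - f2 - f4], this compares the four decompositions. *)
have uniq s z : lin_span (NA (@Num.norm R V)) z -> T s = z -> s = 0.
  move=> Zz Ts; apply: Tinj; rewrite linear0.
  have : [set 0] (T s) by rewrite -ZY; split; [rewrite Ts|exists s].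
  by [].
have sol (u w z : dual V) : u = w + z -> z = u - w by move=> ->; rewrite addrC addKr.
have s3E : s3 = s1 + s2.
  apply/eqP; rewrite -subr_eq0; apply/eqP; apply: (@uniq _ (f1 + f2 - f3)).
    exact: (linear_subspaceB ZL (linear_subspaceD ZL f1Z f2Z) f3Z).
  rewrite linearB linearD (sol _ _ _ E1) (sol _ _ _ E2) (sol _ _ _ E3).
  by rewrite [_ - f1 + _]addrACA -opprD opprB [LHS]addrC subrKA.
have s4E : s4 = s1 - s2.
  apply/eqP; rewrite -subr_eq0; apply/eqP; apply: (@uniq _ (f1 - f2 - f4)).
    exact: (linear_subspaceB ZL (linear_subspaceB ZL f1Z f2Z) f4Z).
  rewrite linearB [T (s1 - s2)]linearB (sol _ _ _ E1) (sol _ _ _ E2) (sol _ _ _ E4).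
  have alg (A B x y z : dual V) : (A - B - z) - ((A - x) - (B - y)) = x - y - z.
    by rewrite [- (B - y)]opprD [A - x + _]addrACA -opprD opprB [LHS]addrC subrKA.
  exact: alg.
have [n vn] : exists n, forall x, x \in [:: x1; x2; x3; x4] -> T (l1_basis n) x != 0.
  apply: (common_nonvanishing (range_subspace T)) => //.
    by move=> x; exact: weak_star_dense_total.
  by rewrite !inE !negb_or ![0 == _]eq_sym x10 x20 x30 x40.
have na : dual_norm p (a *: f) = 1.
  by rewrite dual_norm_equivZ// gtr0_norm// mulVf// gt_eqF.
have nb : dual_norm p (b *: g) = 1.
  by rewrite dual_norm_equivZ// gtr0_norm// mulVf// gt_eqF.
have : `|s1 n| == `|s2 n|.
  by rewrite s1n ?s2n ?na ?nb// vn// !inE eqxx ?orbT.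
(* In one case [s4 n = 0], in the other [s3 n = 0]; yet each modulus is [r n] times a dual norm that
   linear independence makes positive. *)
rewrite eqr_norm2 => /orP[/eqP s12|/eqP s12].
  have /esym/eqP : `|s4 n| = dual_norm p (a *: f - b *: g) * r n.
    by rewrite s4n// vn// !inE eqxx !orbT.
  rewrite s4E [X in `|X|](_ : _ = s1 n - s2 n)// s12 subrr normr0.
  rewrite gt_eqF// mulr_gt0//.
  by apply: pos; rewrite -scaleNr; apply: nz; left; rewrite gt_eqF.
have /esym/eqP : `|s3 n| = dual_norm p (a *: f + b *: g) * r n.
  by rewrite s3n// vn// !inE eqxx !orbT.
rewrite s3E [X in `|X|](_ : _ = s1 n + s2 n)// s12 addNr normr0.
rewrite gt_eqF// mulr_gt0//.
by apply/pos/nz; left; rewrite gt_eqF.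
Qed.

(** Composition with the inverse [psi] carries a plane in [NA (p \o phi)] to a plane in [NA p],
    since [phi] maps the first unit ball onto the second. *)
Lemma read_norm_isomorphism {R : realType} {X W : normedModType R}
    (phi : {linear X -> W}) (p : W -> R) :
  isomorphism phi -> read_norm p -> read_norm (p \o phi).
Proof.
move=> [[c [C [c0 C0 phiE]]] phir] [pN pR].
have pphiN : equivalent_norm (p \o phi).
  have [pD pZ p0 [d [D [d0 D0 pE]]]] := pN.
  split=> [x y|a x|x /p0 px0|] /=.
  - by rewrite linearD pD.
  - by rewrite linearZ pZ.
  - have /andP[] := phiE x; rewrite px0 normr0 pmulr_rle0// normr_le0.
    by move/eqP.
  - exists (d * c), (D * C); split=> [||x]; [exact: mulr_gt0|exact: mulr_gt0|].
    have /andP[cx xC] := phiE x; have /andP[dx xD] := pE (phi x).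
    by rewrite -!mulrA (le_trans _ dx) ?(le_trans xD)// ler_wpM2l// ltW.
split=> // -[L [[f [g [ind ->]]] LNA]]; apply: pR.
have phi_inj : injective phi.
  move=> x y xy; apply/eqP; rewrite -subr_eq0 -normr_le0 -(pmulr_rle0 _ c0).
  have /andP[+ _] := phiE (x - y).
  by rewrite linearB xy subrr normr0.
have /choice[psi phiK] : forall y, exists x, phi x = y.
  move=> y; have [x _ <-] : range phi y by rewrite phir.
  by exists x.
have psil : linear psi by move=> a x y; apply: phi_inj; rewrite linearP !phiK.
pose Psi : {linear W -> X} := HB.pack psi (GRing.isLinear.Build _ _ _ _ _ psil).
have trans (h : dual X) : exists h' : dual W, forall y, h' y = h (psi y).
  pose hP : {linear W -> R^o} := (h : {linear X -> R^o}) \o Psi.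
  apply: (@dual_of_linear _ _ hP (`|h| * c^-1)) => y.
  rewrite (le_trans (ler_norm _))// (le_trans (ler_dual _ _))// -mulrA ler_wpM2l//.
  rewrite mulrC ler_pdivlMr// mulrC.
  by have /andP[+ _] := phiE (psi y); rewrite phiK.
have [f' f'E] := trans f; have [g' g'E] := trans g.
have psiK x : psi (phi x) = x by apply: phi_inj; rewrite phiK.
have comb a b y : (a *: f' + b *: g') y = (a *: f + b *: g) (psi y).
  change (a * f' y + b * g' y = a * f (psi y) + b * g (psi y)).
  by rewrite f'E g'E.
exists [set h | exists a b : R, h = a *: f' + b *: g']; split.
  exists f', g'; split=> // a b fg0; apply: ind.
  apply/val_inj/funext => x.
  by have := comb a b (phi x); rewrite fg0 psiK => /esym.
move=> _ [a [b ->]].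
have [x /= px fx] : NA (p \o phi) (a *: f + b *: g) by apply: LNA; exists a, b.
exists (phi x) => //; rewrite comb psiK; apply: etrans fx; congr sup.
apply/seteqP; split => [_ [y py <-]|_ [y py <-]].
  by exists (psi y); [rewrite /= phiK|congr (`|_|); exact: esym (comb a b y)].
exists (phi y) => //; congr (`|_|).
by apply: etrans (comb a b (phi y)) _; rewrite psiK.
Qed.

(** * An injective operator on l1 with dense columns *)

Section dense_injective_map.
Context {R : realType}.
Let h : R := 2^-1.

Let h0 : 0 <= h. Proof. by rewrite invr_ge0. Qed.
Let h1 : h <= 1. Proof. by rewrite invf_le1// ler1n. Qed.
Let hp : 0 < h. Proof. by rewrite invr_gt0. Qed.

Let h_small (d : R) : 0 < d -> exists m, forall k, (m <= k)%N -> h ^+ k <= d.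
Proof.
move=> d0; have hlt : `|h| < 1 by rewrite ger0_norm// invf_lt1// ltr1n.
have /cvgrPdist_le/(_ _ d0)[m _ hm] := cvg_expr hlt.
by exists m => k /hm; rewrite sub0r normrN ger0_norm// exprn_ge0.
Qed.

Let geometric_psum n N : \sum_(0 <= k < N) `|h ^+ (n.+1 * k)| <= 2.
Proof.
rewrite (@le_trans _ _ (series (geometric 1 h) N))//.
  apply: ler_sum => k _; rewrite ger0_norm ?exprn_ge0// /geometric/= mul1r.
  by rewrite mulSn exprD ler_piMr ?exprn_ge0// exprn_ile1.
apply: le_trans (geometric_le_lim _ _ _ _) _ => //; last first.
  by rewrite div1r [X in X - _]splitr div1r addrK invrK.
by rewrite ger0_norm// invf_lt1// ltr1n.
Qed.

Lemma geometric_l1_subproof n :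
  (fun k => h ^+ (n.+1 * k)) \in summable_seq.
Proof. by apply/summable_seqP; exists 2 => N; exact: geometric_psum. Qed.

Definition geometric_l1 n : l1 R := L1 (geometric_l1_subproof n).

Lemma geometric_l1_norm n : `|geometric_l1 n| <= 2.
Proof. by apply: l1_norm_le => N; exact: geometric_psum. Qed.

Definition rat_l1 (s : seq rat) : l1 R :=
  \sum_(0 <= k < size s) ratr s`_k *: l1_basis k.

Lemma rat_l1E s k : rat_l1 s k = ratr s`_k.
Proof.
rewrite /rat_l1 l1_sumE; have [ks|sk] := ltnP k (size s); last first.
  rewrite nth_default// rmorph0 big1_seq// => i /andP[_].
  rewrite mem_index_iota => /= si.
  rewrite [LHS](_ : _ = ratr s`_i * (k == i)%:R)//.
  by rewrite gtn_eqF ?mulr0// (leq_trans si).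
rewrite (bigD1_seq k) ?iota_uniq ?mem_index_iota//=.
rewrite big1_seq => [|i /andP[ik _]].
  by rewrite addr0 [LHS](_ : _ = ratr s`_k * (k == k)%:R)// eqxx mulr1.
by rewrite [LHS](_ : _ = ratr s`_i * (k == i)%:R)// eq_sym (negPf ik) mulr0.
Qed.

(** Half of [e] pays for truncating [b], the other half for making the remaining coordinates
    rational. *)
Lemma rat_l1_dense (b : l1 R) (e : R) : 0 < e -> exists s, `|rat_l1 s - b| <= e.
Proof.
move=> e0; have e20 : 0 < e / 2 by rewrite divr_gt0.
have bc : (fun N => \sum_(0 <= i < N) b i *: l1_basis i) @ \oo --> b.
  exact: l1_basis_cvg.
have /cvgrPdist_le/(_ _ e20)[N _ /(_ N (leqnn N)) bN] := bc.
(* Dividing by [N.+1] covers [N = 0]. *)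
have [d d0 dE] : exists2 d, 0 < d & d = e / 2 / N.+1%:R.
  by exists (e / 2 / N.+1%:R); rewrite ?divr_gt0.
have /choice[q qb] : forall k, exists q : rat, `|ratr q - b k| <= d.
  move=> k; have bd : b k - d < b k + d.
    by rewrite ltrD2l (lt_trans _ d0)// oppr_lt0.
  have [q] := rat_in_itvoo bd; rewrite in_itv/= => /andP[q1 q2].
  by exists q; rewrite ler_norml lerBrDr addrC (ltW q1) lerBlDl (ltW q2).
exists (mkseq q N); rewrite -[rat_l1 _](subrK (\sum_(0 <= i < N) b i *: l1_basis i)).
rewrite -addrA (le_trans (ler_normD _ _))// [e in leRHS]splitr lerD//; last first.
  by rewrite distrC.
rewrite /rat_l1 size_mkseq -sumrB (le_trans (ler_norm_sum _ _ _))//.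
rewrite (@le_trans _ _ (\sum_(0 <= i < N) d))//.
  rewrite big_nat [leRHS]big_nat; apply: ler_sum => i /andP[_ iN].
  rewrite -scalerBl normrZ nth_mkseq// -[leRHS]mulr1.
  by apply: ler_pM => //; exact: l1_basis_norm_le1.
rewrite sumr_const_nat subn0 -[leRHS](@divfK _ N.+1%:R)// -dE -[leLHS]mulr_natr.
by rewrite ler_wpM2l ?(ltW d0)// ler_nat.
Qed.

(** Enumerates all pairs of a rational vector and an exponent that scales its perturbation; numbers
    coding no pair get a harmless default. *)
Let code n : seq rat * nat := odflt ([::], 0%N) (unpickle n).
(** The weight is small enough for the rational part to obey the decay of [geometric_l1 n] on its
    whole support. *)
Let c n : R := h ^+ (n.+1 * size (code n).1) / (1 + `|rat_l1 (code n).1|).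

Let den0 s : 0 < 1 + `|rat_l1 s|. Proof. by rewrite ltr_pwDl. Qed.

Let c0 n : 0 < c n. Proof. by rewrite divr_gt0// exprn_gt0. Qed.

Let c1 n : c n <= 1.
Proof. by rewrite ler_pdivrMr// mul1r (le_trans (exprn_ile1 _ _ _))// lerDl. Qed.

Let cd n k : c n * `|rat_l1 (code n).1 k| <= h ^+ (n.+1 * k).
Proof.
have [ks|sk] := ltnP k (size (code n).1); last first.
  by rewrite rat_l1E nth_default// rmorph0 normr0 mulr0 exprn_ge0.
rewrite /c mulrAC ler_pdivrMr// ler_pM ?exprn_ge0//.
  by rewrite ler_wiXn2l// leq_mul2l ltnW ?orbT.
apply: (@le_trans _ _ `|rat_l1 (code n).1|); last by rewrite lerDr.
apply: le_trans (l1_psum_le _ k.+1).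
by rewrite big_nat_recr//= lerDr sumr_ge0.
Qed.

(** Column [n] of the operator. The geometric term keeps every coordinate beyond the rational
    support nonzero; its factor can be arbitrarily small, which preserves density. *)
Let al n : l1 R :=
  c n *: (rat_l1 (code n).1 + h ^+ (code n).2 *: geometric_l1 n).

Let alE n k : al n k =
  c n * (rat_l1 (code n).1 k + h ^+ (code n).2 * h ^+ (n.+1 * k)).
Proof. by []. Qed.

Let al_le n k : `|al n k| <= 2 * h ^+ (n.+1 * k).
Proof.
rewrite alE mulrDr (le_trans (ler_normD _ _))// mulr_natl mulr2n lerD//.
  by rewrite normrM gtr0_norm// cd.
rewrite ger0_norm ?mulr_ge0 ?exprn_ge0 ?(ltW (c0 n))// mulrA.
by rewrite ler_piMl ?exprn_ge0// mulr_ile1 ?exprn_ge0 ?(ltW (c0 n))// exprn_ile1.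
Qed.

Let al_norm n : `|al n| <= 4.
Proof.
apply: l1_norm_le => N.
rewrite (@le_trans _ _ (\sum_(0 <= k < N) 2 * `|geometric_l1 n k|))//.
  apply: ler_sum => k _; rewrite (le_trans (al_le n k))// ler_wpM2l//.
  exact: ler_norm.
rewrite -mulr_sumr (le_trans (ler_wpM2l _ (l1_psum_le _ _)))//.
by have := geometric_l1_norm n; lra.
Qed.

(* Row n decays like 2^-(n+1)k up to a rational vector of finite support, so at
   large coordinates the first nonzero coefficient of a dominates A a. *)
Lemma dense_injective_l1_map : exists A : {linear l1 R -> l1 R},
  [/\ continuous A,
      forall a, (exists N, forall k, (N <= k)%N -> A a k.*2 = 0) -> a = 0 &
      forall b e, 0 < e -> exists n c, 0 < c /\ `|c *: A (l1_basis n) - b| <= e].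
Proof.
have [A [Ac AE]] := l1_map_ext al_norm.
exists A; split=> // [a [N aN]|b e e0]; last first.
  have e20 : 0 < e / 2 by rewrite divr_gt0.
  have e40 : 0 < e / 2 / 2 by rewrite divr_gt0.
  have [s sb] := rat_l1_dense b e20; have [m /(_ m (leqnn m)) hm] := h_small e40.
  (* Undoing the weight leaves [rat_l1 s] plus a perturbation of norm at most [e / 4] times 2. *)
  pose n := pickle (s, m); exists n, (c n)^-1; split; first by rewrite invr_gt0.
  rewrite AE /al scalerA mulVf ?gt_eqF// scale1r /code pickleK/= addrAC.
  rewrite (le_trans (ler_normD _ _))// [e]splitr lerD// normrZ ger0_norm ?exprn_ge0//.
  rewrite -[e / 2](@divfK _ 2)//; apply: ler_pM => //; first exact: exprn_ge0.
  exact: geometric_l1_norm.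
apply: contrapT => a0.
have exn : exists n, a n != 0.
  apply: contrapT => an; apply: a0; apply/val_inj/funext => n.
  by apply: contrapT => /eqP an0; apply: an; exists n.
pose n0 := ex_minn exn; have [an0 nmin] : a n0 != 0 /\ forall n, a n != 0 -> (n0 <= n)%N.
  by rewrite /n0; case: ex_minnP.
pose a' := a - a n0 *: l1_basis n0.
have a'n n : a' n != 0 -> (n0 < n)%N.
  rewrite [a' n](_ : _ = a n - a n0 * (n == n0)%:R)//.
  have [->|nn0] := eqVneq n n0; first by rewrite mulr1 subrr eqxx.
  by rewrite mulr0 subr0 => /nmin; rewrite leq_eqVlt eq_sym (negPf nn0).
set s := (code n0).1; pose q := c n0 * h ^+ (code n0).2.
have q0 : 0 < q by rewrite mulr_gt0// exprn_gt0.
(* Since [A a] vanishes at coordinate [k.*2], the term of [n0] there, of exact order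
   [h ^+ (n0.+1 * k.*2)], is cancelled by later columns, which decay at least like
   [h ^+ (n0.+2 * k.*2)]. *)
have key k : (N <= k)%N -> (size s <= k.*2)%N ->
    `|a n0| * q <= 2 * `|a'| * h ^+ k.*2.
  move=> Nk sk.
  pose ev (u : l1 R) : R^o := A u k.*2.
  have evl : linear ev by move=> t u u'; rewrite /ev linearP.
  pose Ev : {linear l1 R -> R^o} := HB.pack ev (GRing.isLinear.Build _ _ _ _ _ evl).
  have Evc : continuous Ev.
    have [C C0 AC] := (bounded_linearP A).1 Ac.
    apply/bounded_linearP; exists C => // u; apply: le_trans (AC u).
    rewrite (le_trans _ (l1_psum_le _ k.*2.+1))// big_nat_recr//= lerDr.
    exact: sumr_ge0.
  have Eva' : Ev a' = - (a n0 * al n0 k.*2).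
    rewrite /a' linearB linearZ/= /ev aN// sub0r AE//.
  have : `|Ev a'| <= 2 * h ^+ (n0.+2 * k.*2) * `|a'|.
    apply: l1_map_bound => [//||n /a'n n0n]; first by rewrite mulr_ge0// exprn_ge0.
    rewrite /= /ev AE (le_trans (al_le _ _))// ler_wpM2l//.
    by rewrite ler_wiXn2l// leq_mul2r ltnS n0n orbT.
  have hk : 0 < h ^+ (n0.+1 * k.*2) by rewrite exprn_gt0.
  have alq : al n0 k.*2 = q * h ^+ (n0.+1 * k.*2).
    by rewrite alE rat_l1E nth_default// rmorph0 add0r mulrA.
  rewrite Eva' normrN normrM alq (ger0_norm (ltW (mulr_gt0 q0 hk))).
  rewrite [(n0.+2 * _)%N]mulSn exprD.
  rewrite [leRHS](_ : _ = 2 * `|a'| * h ^+ k.*2 * h ^+ (n0.+1 * k.*2)); last by ring.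
  by rewrite [_ * (q * _)]mulrA ler_pM2r.
have [m hm] : exists m, forall k, (m <= k)%N -> 2 * `|a'| * h ^+ k < `|a n0| * q.
  have d0 : 0 < `|a n0| * q / (2 * `|a'| + 1).
    have an : 0 < `|a n0| by rewrite normr_gt0.
    by rewrite divr_gt0 ?(mulr_gt0 an q0)// ltr_wpDl// mulr_ge0.
  have [m hm] := h_small d0; exists m => k /hm.
  rewrite ler_pdivlMr ?ltr_wpDl ?mulr_ge0// => /(lt_le_trans _); apply.
  by rewrite mulrDr mulr1 mulrC ltrDl exprn_gt0.
pose k := maxn N (maxn (size s) m).
have kk : (k <= k.*2)%N by rewrite -addnn leq_addr.
have sk : (size s <= k.*2)%N by rewrite (leq_trans _ kk)// !leq_max leqnn orbT.
have := key k (leq_maxl _ _) sk; rewrite leNgt hm//.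
by rewrite (leq_trans _ kk)// !leq_max leqnn !orbT.
Qed.

End dense_injective_map.

(** * Renorming a space containing c0 *)

Section c0_basis.
Context {R : realType}.

Lemma c0_basis_subproof (n : nat) : (fun k => (k == n)%:R : R) \in null_seq.
Proof.
rewrite inE; apply: cvg_near_cst; exists n.+1 => // k /= nk.
by rewrite gtn_eqF.
Qed.

Definition c0_basis (n : nat) : c0 R := C0 (c0_basis_subproof n).

Lemma c0_sum_basis (a : nat -> R) N k :
  (\sum_(0 <= i < N) a i *: c0_basis i) k = if (k < N)%N then a k else 0.
Proof.
rewrite (_ : (\sum_(0 <= i < N) a i *: c0_basis i) k =
    \sum_(0 <= i < N) a i * (k == i)%:R); last first.
  by elim/big_rec2: _ => // i x y _ <-.
have [kN|Nk] := ltnP k N.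
  rewrite (bigD1_seq k) ?iota_uniq ?mem_index_iota//= eqxx mulr1.
  by rewrite big1_seq ?addr0// => i /andP[ik _]; rewrite eq_sym (negPf ik) mulr0.
rewrite big1_seq// => i; rewrite mem_index_iota => /= iN.
by rewrite gtn_eqF ?mulr0// (leq_trans iN).
Qed.

Lemma c0_functional_l1 (f : {linear c0 R -> R^o}) C : 0 <= C ->
  (forall z, `|f z| <= C * `|z|) ->
  exists2 b : l1 R, (forall k, b k = f (c0_basis k)) & `|b| <= C.
Proof.
move=> C0 fC.
have bN N : \sum_(0 <= k < N) `|f (c0_basis k)| <= C.
  (* A sign vector in the unit ball of c0 turns the sum of moduli into one value of [f]. *)
  pose z := \sum_(0 <= k < N) Num.sg (f (c0_basis k)) *: c0_basis k.
  have -> : \sum_(0 <= k < N) `|f (c0_basis k)| = f z.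
    rewrite /z linear_sum; apply: eq_bigr => k _.
    by rewrite linearZ/= normrEsg.
  rewrite (le_trans (ler_norm _))// (le_trans (fC z))// ler_piMr//.
  apply: c0_norm_le => k; rewrite c0_sum_basis; case: ifP => _; rewrite ?normr0//.
  by rewrite normr_sg; case: eqP.
have bs : (fun k => f (c0_basis k) : R) \in summable_seq.
  by apply/summable_seqP; exists C.
by exists (L1 bs) => //; exact: l1_norm_le.
Qed.

End c0_basis.

(* The even functionals extend the coordinates of the copy of c0; the odd ones
   are the given norming functionals corrected so as to vanish on that copy. *)
Lemma biorthogonal_norming_system {R : realType} (X : completeNormedModType R)
    (xs : nat -> dual X) :
  contains_c0 X -> countable_norming_system xs ->
  exists (G : nat -> dual X) (u : nat -> X),
  [/\ exists C, forall n, `|G n| <= C,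
      exists2 K, 0 <= K &
        forall x M, (forall n, `|G n x| <= M) -> `|x| <= K * M &
      forall i k, G i (u k) = (i == k.*2)%:R].
Proof.
move=> [J [c [C [c0 C0 JE]]]] [xsB [K K0 xsK]].
have [B B0 xB] : exists2 B, 0 <= B & forall n, `|xs n| <= B.
  have /filter_ex[B [B0 HB]] : \forall B \near +oo,
      0 <= B /\ range xs `<=` [set f | `|f| <= B].
    by apply: filterS2 (nbhs_pinfty_ge (num_real 0)) xsB => B.
  by exists B => // n; apply: HB; exists n.
pose u k := J (c0_basis k).
have /choice[g gE] : forall n, exists f : dual X,
    (forall x, `|f x| <= c^-1 * `|x|) /\ forall z, f (J z) = z n.
  move=> n.
  pose e (z : Defs.c0 R) : R^o := z n.
  have el : linear e by [].
  pose E : {linear Defs.c0 R -> R^o} := HB.pack e (GRing.isLinear.Build _ _ _ _ _ el).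
  have [||z|g [gc gJ]] := @hahn_banach _ _ _ J E (fun x => c^-1 * `|x|).
  - by move=> x y; rewrite -mulrDr ler_wpM2l ?ler_normD// invr_ge0 ltW.
  - by move=> a x a0; rewrite normrZ ger0_norm// mulrCA.
  - have /andP[cz _] := JE z; rewrite mulrC ler_pdivlMr// mulrC (le_trans _ cz)//.
    rewrite ler_wpM2l ?(ltW c0)// (le_trans (ler_norm _))//; exact: c0_norm_ub.
  have [f fg] := @dual_of_linear _ _ g c^-1 gc.
  exists f; split=> [x|z]; last by rewrite fg gJ.
  by rewrite fg ler_norml gc andbT lerNl -linearN -[`|x|]normrN gc.
have gnorm n : `|g n| <= c^-1.
  apply: dual_norm_le => [|x x1]; first by rewrite invr_ge0 ltW.
  by rewrite (le_trans ((gE n).1 x))// ler_piMr// invr_ge0 ltW.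
(* [Gam a] is the sum of the [a n *: g n]; it takes the value [a k] at [u k], so subtracting
   [Gam (b n)] from [xs n] kills every [u k]. *)
have [Gam [Gamc GamE]] := l1_map_ext gnorm.
have Gam_le a x M : 0 <= M -> (forall n, `|g n x| <= M) -> `|Gam a x| <= M * `|a|.
  move=> M0 gM; have [E [Ec EE]] := l1_map_eval x Gamc.
  by rewrite -EE; apply: l1_map_bound => // n _; rewrite EE GamE.
have Gamu a k : Gam a (u k) = a k.
  have [E [Ec EE]] := l1_map_eval (u k) Gamc.
  rewrite -EE; apply: (cvg_unique (@norm_hausdorff _ R^o) (@l1_map_cvg _ _ _ Ec a)).
  apply: cvg_near_cst; exists k.+1 => // N /= kN.
  under eq_bigr do rewrite EE GamE (gE _).2.
  have := @l1_sum_basis _ a N k; rewrite kN l1_sumE => <-.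
  apply: eq_bigr => i _; change (a i * (i == k)%:R = a i * (k == i)%:R).
  by rewrite eq_sym.
have /choice[b bE] : forall n, exists a : l1 R,
    (forall k, a k = xs n (u k)) /\ `|a| <= B * C.
  move=> n.
  have BC0 : 0 <= B * C by rewrite mulr_ge0// ltW.
  have [z|b bE bC] := @c0_functional_l1 R ((xs n : {linear X -> R^o}) \o J) _ BC0.
    rewrite /= (le_trans (ler_dual _ _))// -mulrA; have /andP[_ zC] := JE z.
    by apply: ler_pM.
  by exists b.
pose h n : dual X := xs n - Gam (b n).
exists (fun i => if odd i then h i./2 else g i./2), u; split.
- exists (c^-1 + (B + c^-1 * (B * C))) => i.
  have hB : `|h i./2| <= B + c^-1 * (B * C).
    rewrite (le_trans (ler_normB _ _))// lerD//.
    have ic : 0 <= c^-1 by rewrite invr_ge0 ltW.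
    rewrite (le_trans _ (ler_wpM2l ic (bE i./2).2))//.
    by apply: l1_map_bound => // n _; rewrite GamE.
  case: ifP => _.
    by rewrite (le_trans hB)// lerDr invr_ge0 ltW.
  by rewrite (le_trans (gnorm _))// lerDl (le_trans _ hB).
(* In [xs n = h n + Gam (b n)] the summands contribute at most [M] and [M * (B * C)]. *)
- exists (K * (1 + B * C)); first by rewrite mulr_ge0// addr_ge0// mulr_ge0// ltW.
  move=> x M GM.
  have M0 : 0 <= M by rewrite (le_trans _ (GM 0%N)).
  have gM n : `|g n x| <= M by have := GM n.*2; rewrite odd_double doubleK.
  have hM n : `|h n x| <= M by have := GM n.*2.+1; rewrite /= odd_double/= uphalf_double.
  rewrite (le_trans (xsK x))// -mulrA ler_wpM2l// mulrDl mul1r.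
  apply: sup_le_ub0 => [|_ [n _ <-]].
    by rewrite addr_ge0// mulr_ge0// mulr_ge0// ltW.
  have -> : xs n x = h n x + Gam (b n) x.
    by rewrite [h n x](_ : _ = xs n x - Gam (b n) x)// subrK.
  rewrite (le_trans (ler_normD _ _))// lerD//.
  by rewrite (le_trans (Gam_le _ _ _ M0 gM))// mulrC ler_wpM2r// (bE n).2.
- move=> i k; case: ifP => oi.
    rewrite [LHS](_ : _ = xs i./2 (u k) - Gam (b i./2) (u k))// Gamu (bE _).1 subrr.
    by case: eqP oi => // ->; rewrite odd_double.
  rewrite (gE _).2 /= -{2}(odd_double_half i) oi add0n.
  by rewrite (inj_eq double_inj).
Qed.

Definition renormed {R : realType} {X : completeNormedModType R} {q : X -> R}
  (qN : equivalent_norm q) : Type := X.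

Section renormed.
Context {R : realType} {X : completeNormedModType R} {q : X -> R}.
Variable qN : equivalent_norm q.
Local Notation W := (renormed qN).

HB.instance Definition _ := GRing.Lmodule.copy W X.

Let qD (x y : W) : q (x + y) <= q x + q y.
Proof. by have [+ _ _ _] := qN; apply. Qed.

Let qZ a (x : W) : q (a *: x) = `|a| * q x.
Proof. by have [_ + _ _] := qN; apply. Qed.

Let q0 (x : W) : q x = 0 -> x = 0.
Proof. by have [_ _ + _] := qN; apply. Qed.

HB.instance Definition _ := @Lmodule_isNormed.Build R W q qD qZ q0.

Lemma renormed_complete (F : set_system W) : ProperFilter F -> cauchy F -> cvg F.
Proof.
have [_ _ _ [c [C [c0 C0 qE]]]] := qN.
move=> FF /cauchy_ballP Fc.
have FcX : cauchy (F : set_system X).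
  apply/cauchy_ballP => e e0; have := Fc (c * e) (mulr_gt0 c0 e0).
  apply: filterS => -[x y]; rewrite -!ball_normE/= => xy.
  rewrite -(ltr_pM2l c0) (le_lt_trans _ xy)//.
  by have /andP[] := qE (x - y).
have /cvg_ex[x Fx] := @cauchy_cvg X F FF FcX.
apply/cvg_ex; exists x; apply/(@cvgrPdist_le R W) => e e0.
have eC : 0 < e / C by rewrite divr_gt0.
have /cvgrPdist_le/(_ _ eC) := Fx.
apply: filterS => y; rewrite ler_pdivlMr// mulrC; apply: le_trans.
by have /andP[] := qE (x - y).
Qed.

HB.instance Definition _ := Uniform_isComplete.Build W renormed_complete.

Let to_renormed (x : X) : W := x.

Let to_renormed_linear : linear to_renormed. Proof. by []. Qed.

Lemma renormed_isomorphism : exists phi : {linear X -> W},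
  [/\ isomorphism phi, forall x, phi x = x :> X & forall x, `|phi x| = q x].
Proof.
exists (HB.pack to_renormed (GRing.isLinear.Build _ _ _ _ _ to_renormed_linear)
  : {linear X -> W}).
have [_ _ _ [c [C [c0 C0 qE]]]] := qN.
split=> //; split; first by exists c, C.
by apply/seteqP; split=> // x _; exists x.
Qed.

End renormed.

(** * A renorming whose unit ball has flat pieces along the copy of c0 *)

Section flat_norm.
Context {R : realType} {X : completeNormedModType R}.
Variables (G : nat -> dual X) (u : nat -> X) (C K : R).
Hypotheses (GC : forall n, `|G n| <= C) (K0 : 0 <= K).
Hypothesis GK : forall x M, (forall n, `|G n x| <= M) -> `|x| <= K * M.
Hypothesis Gu : forall i k, G i (u k) = (i == k.*2)%:R.

Let bd x : set R := [set M | (forall n, `|G n x| <= M) /\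
  exists N, forall n, (N <= n)%N -> `|G n x| <= M / 2].

(* The larger of sup_n |G_n x| and 2 limsup_n |G_n x|. *)
Definition flat_norm x := inf (bd x).

Let bd_ge0 x M : bd x M -> 0 <= M.
Proof. by move=> [xM _]; rewrite (le_trans _ (xM 0%N)). Qed.

Let C0 : 0 <= C. Proof. by rewrite (le_trans _ (GC 0%N)). Qed.

Let GCx n x : `|G n x| <= C * `|x|.
Proof. by rewrite (le_trans (ler_dual _ _))// ler_wpM2r. Qed.

Let bd_C x : bd x (2 * (C * `|x|)).
Proof.
have C2 : 0 <= C * `|x| by rewrite mulr_ge0.
split=> [n|]; first by rewrite (le_trans (GCx n x))// ler_peMl// ler1n.
by exists 0%N => n _; rewrite mulrAC divff// mul1r.
Qed.

Let bd_inf x : has_inf (bd x).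
Proof. by split; [exists (2 * (C * `|x|)); exact: bd_C|exists 0 => M /bd_ge0]. Qed.

Let flat_le x M : bd x M -> flat_norm x <= M.
Proof. by move=> xM; apply: ge_inf => //; case: (bd_inf x). Qed.

Let flat_ge x m : (forall M, bd x M -> m <= M) -> m <= flat_norm x.
Proof. by move=> mM; apply: lb_le_inf; [case: (bd_inf x)|move=> M /mM]. Qed.

(** Admissible bounds are upward closed, but their infimum need not be admissible, hence the strict
    inequality. *)
Let flat_lt x M : flat_norm x < M -> bd x M.
Proof.
move=> /(inf_lt (bd_inf x).1)[M' [xM [N xN]] /ltW M'M].
split=> [n|]; first exact: le_trans M'M.
by exists N => n /xN /le_trans; apply; rewrite ler_pM2r// invr_gt0.
Qed.

Let flat_ge0 x : 0 <= flat_norm x.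
Proof. by apply: flat_ge => M /bd_ge0. Qed.

Lemma flat_norm_ub n x : `|G n x| <= flat_norm x.
Proof. by apply: flat_ge => M [xM _]. Qed.

Lemma flat_norm_equivalent : equivalent_norm flat_norm.
Proof.
split.
- move=> x y; rewrite -lerBlDr; apply: flat_ge => M [xM [N xN]].
  rewrite lerBlDr -lerBlDl; apply: flat_ge => M' [yM [N' yN]].
  rewrite lerBlDl; apply: flat_le; split=> [n|].
    by rewrite linearD (le_trans (ler_normD _ _))// lerD ?xM ?yM.
  exists (maxn N N') => n; rewrite geq_max => /andP[/xN xn /yN yn].
  by rewrite linearD (le_trans (ler_normD _ _))// mulrDl lerD ?xn ?yn.
- apply: seminorm_homog => // a x.
  have [->|a0] := eqVneq a 0.
    rewrite scale0r normr0 mul0r; apply: flat_le.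
    by split=> [n|]; [|exists 0%N => n _]; rewrite linear0 normr0// mul0r.
  have na : 0 < `|a| by rewrite normr_gt0.
  rewrite mulrC -ler_pdivrMr//; apply: flat_ge => M [xM [N xN]].
  rewrite ler_pdivrMr// mulrC; apply: flat_le; split=> [n|].
    by rewrite linearZ/= normrM ler_wpM2l.
  by exists N => n /xN xn; rewrite linearZ/= normrM -mulrA ler_wpM2l.
- move=> x x0; apply/normr0_eq0/le_anti; rewrite normr_ge0 andbT.
  rewrite -(mulr0 K); apply: GK => n; rewrite -x0; exact: flat_norm_ub.
- have K1 : 0 < K + 1 by rewrite ltr_wpDl.
  exists (K + 1)^-1, (2 * C + 1); split=> [||x].
  + by rewrite invr_gt0.
  + by rewrite ltr_wpDl// mulr_ge0.
  + apply/andP; split; last first.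
      by rewrite (le_trans (flat_le (bd_C x)))// [leRHS]mulrDl mul1r mulrA lerDl.
    rewrite mulrC ler_pdivrMr// mulrDr mulr1 mulrC.
    rewrite (@le_trans _ _ (K * flat_norm x))// ?lerDl//.
    by apply: GK => n; exact: flat_norm_ub.
Qed.

(** As [1 < 3 / 2], eventually the modulus of [G n x] is at most 3/4. Adding [a *: u n] changes only
    the value of [G n.*2], by at most 1/4, and leaves the limsup alone. *)
Lemma flat_norm_perturb x : flat_norm x <= 1 -> exists N, forall n a, (N <= n)%N ->
  `|a| <= 4^-1 -> flat_norm (x + a *: u n) <= 1.
Proof.
move=> x1; have [|_ [N xN]] := @flat_lt x (3 / 2).
  by rewrite (le_lt_trans x1)//; lra.
exists N => n a Nn a4; apply/ler_addgt0Pr => e e0.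
have [xe [N' xN']] : bd x (1 + e) by apply: flat_lt; rewrite (le_lt_trans x1)// ltrDl.
have Ga i : G i (x + a *: u n) = G i x + a * (i == n.*2)%:R.
  by rewrite linearD linearZ/= Gu.
apply: flat_le; split=> [i|].
  rewrite Ga; have [->|_] := eqVneq i n.*2; last by rewrite mulr0 addr0.
  have := xN n.*2; rewrite -addnn (leq_trans Nn (leq_addr _ _)) => /(_ isT) xn.
  rewrite mulr1 (le_trans (ler_normD _ _))// (le_trans (lerD xn a4))//.
  by lra.
exists (maxn N' n.*2.+1) => i; rewrite geq_max => /andP[/xN' xi ni].
by rewrite Ga gtn_eqF// mulr0 addr0.
Qed.

End flat_norm.

(** At an attaining point [x], both [x + u n / 4] and [x - u n / 4] stay in the ball, and one of
    them would raise the modulus of [f] unless [f (u n) = 0]. *)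
Lemma NA_vanishes {R : realType} {W : normedModType R} (u : nat -> W) (f : dual W) :
  (forall x, `|x| <= 1 -> exists N, forall n a, (N <= n)%N ->
    `|a| <= 4^-1 -> `|x + a *: u n| <= 1) ->
  NA (@Num.norm R W) f -> exists N, forall n, (N <= n)%N -> f (u n) = 0.
Proof.
move=> uP [x x1 fx]; have [N xN] : exists N, forall n a, (N <= n)%N ->
    `|a| <= 4^-1 -> `|x + a *: u n| <= 1 by apply: uP; rewrite x1.
exists N => n Nn.
have q0 : 0 < 4^-1 :> R by rewrite invr_gt0.
have le a : `|a| <= 4^-1 -> `|f x + a * f (u n)| <= `|f x|.
  move=> a4; rewrite -fx; have := dual_norm_ub f (xN n a Nn a4).
  by rewrite linearD linearZ.
have le1 := le 4^-1; have le2 := le (- 4^-1).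
rewrite normrN gtr0_norm// in le1 le2 *.
have {le1}le1 := le1 (lexx _); have {le2}le2 := le2 (lexx _).
move: le1 le2; rewrite mulNr.
set b := 4^-1 * f (u n).
have [b0|] := eqVneq b 0.
  by move=> _ _; apply/eqP; move/eqP: b0; rewrite mulf_eq0 gt_eqF.
move=> b0; have [fx0|fx0] := leP 0 (f x).
  rewrite !ler_norml (ger0_norm fx0) !gerDl oppr_le0 => /andP[_ h1] /andP[_ h2].
  by case/eqP: b0; apply/le_anti; rewrite h1.
rewrite !ler_norml (ltr0_norm fx0) opprK !lerDl oppr_ge0 => /andP[h1 _] /andP[h2 _].
by case/eqP: b0; apply/le_anti; rewrite h1 h2.
Qed.

(** * The operator range *)

Lemma lin_span_seq {R : realType} {W : lmodType R} (s : seq W) x :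
  lin_span [set` s] x ->
  exists c : 'I_(size s) -> R, x = \sum_(i < size s) c i *: s`_i.
Proof.
apply: (@lin_span_sub _ _ _
  [set y | exists c : 'I_(size s) -> R, y = \sum_(i < size s) c i *: s`_i]).
  split=> [|a _ _ [c ->] [d ->]].
    by exists (fun=> 0); rewrite big1// => i _; rewrite scale0r.
  exists (fun i => a * c i + d i); rewrite scaler_sumr -big_split.
  by apply: eq_bigr => i _; rewrite scalerDl scalerA.
move=> y /= /[dup] ys; rewrite -index_mem => iy.
exists (fun i => (i == Ordinal iy)%:R); rewrite (bigD1 (Ordinal iy))//=.
rewrite eqxx scale1r nth_index// big1 ?addr0// => i /negPf ->.
by rewrite scale0r.
Qed.

(** Expressing [(size s).+1] basis vectors through [s] gives a coefficient matrix with a nonzero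
    left kernel, that is, a linear relation between basis vectors. *)
Lemma l1_infinite_dimensional {R : realType} : infinite_dimensional (l1 R).
Proof.
move=> s sT.
have /choice[a aE] : forall k, exists c : 'I_(size s) -> R,
    l1_basis k = \sum_(i < size s) c i *: s`_i.
  by move=> k; apply: lin_span_seq; rewrite sT.
pose A : 'M[R]_((size s).+1, size s) := \matrix_(k, i) a k i.
have : kermx A != 0.
  by rewrite -mxrank_eq0 mxrank_ker -lt0n subn_gt0 ltnS rank_leq_col.
move=> /rowV0Pn[v /sub_kermxP vA /rV0Pn[k vk]].
have : \sum_(j < (size s).+1) v ord0 j *: l1_basis j = 0 :> l1 R.
  under eq_bigr do rewrite aE scaler_sumr; rewrite exchange_big big1//= => i _.
  under eq_bigr do rewrite scalerA; rewrite -scaler_suml.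
  have := congr1 (fun M : 'rV_(size s) => M ord0 i) vA; rewrite !mxE.
  under eq_bigr do rewrite mxE; move=> ->.
  by rewrite scale0r.
move=> /(congr1 (fun x : l1 R => x k)); rewrite l1_sumE (bigD1 k)//= big1.
  rewrite addr0 [LHS](_ : _ = v ord0 k * (k == k :> nat)%:R)// eqxx mulr1.
  by move/eqP; rewrite (negPf vk).
move=> j jk; rewrite [LHS](_ : _ = v ord0 j * (k == j :> nat)%:R)//.
by rewrite eq_sym (inj_eq val_inj) (negPf jk) mulr0.
Qed.

Lemma normalize_dist {R : realType} {W : normedModType R} (y w : W) d :
  `|y| = 1 -> `|w - y| <= d -> `| `|w|^-1 *: w - y| <= d + d.
Proof.
(* For [w = 0] the normalized vector is 0, and [d] is at least 1. *)
move=> y1 wy; have [w0|w0] := eqVneq w 0.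
  move: wy; rewrite w0 scaler0 !sub0r normrN y1 => d1.
  by rewrite (le_trans d1)// lerDl (le_trans _ d1).
have nw : `|w| != 0 by rewrite normr_eq0.
rewrite -[X in X - y](subrK w) -addrA (le_trans (ler_normD _ _))// lerD//.
rewrite -[X in _ - X]scale1r -scalerBl normrZ -[`|w|](normr_id) -normrM.
rewrite mulrBl normr_id mulVf// mul1r -y1 (le_trans (ler_dist_dist _ _))//.
by rewrite distrC.
Qed.

Section construction.
Context {R : realType} {W : completeNormedModType R}.
Variables (G : nat -> dual W) (u : nat -> W) (C : R).
Hypothesis GC : forall n, `|G n| <= C.
Hypothesis G_total : forall x, (forall n, G n x = 0) -> x = 0.
Hypothesis Gu : forall i k, G i (u k) = (i == k.*2)%:R.
Hypothesis NA_u : forall f, NA (@Num.norm R W) f ->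
  exists N, forall n, (N <= n)%N -> f (u n) = 0.

(** Eventual vanishing along [u], with a threshold depending on the functional, is stable under
    linear combinations. *)
Lemma span_NA_vanishes f : lin_span (NA (@Num.norm R W)) f ->
  exists N, forall n, (N <= n)%N -> f (u n) = 0.
Proof.
apply: (@lin_span_sub _ _ _
  [set g : dual W | exists N, forall n, (N <= n)%N -> g (u n) = 0]) => //.
split=> [|a g h [N gN] [M hM]]; first by exists 0%N.
exists (maxn N M) => n; rewrite geq_max => /andP[/gN gn /hM hn].
by rewrite [LHS](_ : _ = a * g (u n) + h (u n))// gn hn mulr0 addr0.
Qed.

(** [T] is [Phi \o A] scaled to norm one. Evaluation at [u k] reads the coordinate [k.*2] of [A a],
    so the injectivity of [A] on tails separates the range from the span of NA; the dense columns of
    [A] give the rest. *)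
Lemma weak_star_modest_operator : exists T : {linear l1 R -> dual W},
  [/\ [/\ continuous T, injective T & op_norm T = 1],
      modesty_witness (range T) (lin_span (NA (@Num.norm R W))) &
      [set y | range T y /\ `|y| = 1] `<=`
        closure (range (fun n => `|T (l1_basis n)|^-1 *: T (l1_basis n)))].
Proof.
have [A [Ac Ainj Ad]] := @dense_injective_l1_map R.
have [Phi [Phic PhiE]] := l1_map_ext GC.
have [D D0 PhiD] := (bounded_linearP Phi).1 Phic.
have [B B0 AB] := (bounded_linearP A).1 Ac.
have Phiu b k : Phi b (u k) = b k.*2.
  have [E [Ec EE]] := l1_map_eval (u k) Phic.
  rewrite -EE; apply: (cvg_unique (@norm_hausdorff _ R^o) (@l1_map_cvg _ _ _ Ec b)).
  apply: cvg_near_cst; exists k.*2.+1 => // N /= kN.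
  under eq_bigr do rewrite EE PhiE Gu.
  have := @l1_sum_basis _ b N k.*2; rewrite kN l1_sumE => <-.
  apply: eq_bigr => i _; change (b i * (i == k.*2)%:R = b i * (k.*2 == i)%:R).
  by rewrite eq_sym.
pose T0 : {linear l1 R -> dual W} := Phi \o A.
have T0B x : `|T0 x| <= D * B * `|x|.
  by rewrite (le_trans (PhiD _))// -mulrA ler_wpM2l.
have T0inj x : (exists N, forall n, (N <= n)%N -> T0 x (u n) = 0) -> x = 0.
  by move=> [N xN]; apply: Ainj; exists N => k /xN; rewrite Phiu.
set M := op_norm T0.
have MB x : `|x| <= 1 -> `|T0 x| <= M.
  move=> x1; apply: (@sup_ub_le _ _ (D * B)); last by exists x.
  by move=> _ [y y1 <-]; rewrite (le_trans (T0B y))// ler_piMr// mulr_ge0.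
have M0 : 0 < M.
  apply: lt_le_trans (MB _ (l1_basis_norm_le1 0)); rewrite normr_gt0; apply/eqP => T00.
  have /(congr1 (fun x : l1 R => x 0%N)) : l1_basis 0 = 0 :> l1 R.
    by apply: T0inj; exists 0%N => n _; rewrite T00.
  by move=> /eqP; rewrite l1_basisE eqxx oner_eq0.
have Mi0 : 0 < M^-1 by rewrite invr_gt0.
pose t x := M^-1 *: T0 x.
have tl : linear t.
  by move=> a x y; rewrite /t linearP scalerDr !scalerA mulrC.
pose T : {linear l1 R -> dual W} := HB.pack t (GRing.isLinear.Build _ _ _ _ _ tl).
have TE x : T x = M^-1 *: T0 x by [].
have TM x : M *: T x = T0 x by rewrite TE scalerA divff ?scale1r// gt_eqF.
have Tc : continuous T.
  apply/bounded_linearP; exists (M^-1 * (D * B)) => [|x].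
    by rewrite !mulr_ge0// ltW.
  by rewrite TE normrZ gtr0_norm// -mulrA ler_wpM2l// ltW.
have Tinj0 x : (exists N, forall n, (N <= n)%N -> T x (u n) = 0) -> x = 0.
  move=> [N xN]; apply: T0inj; exists N => n /xN xn.
  by rewrite -TM [LHS](_ : _ = M * T x (u n))// xn mulr0.
have Tinj : injective T.
  move=> x y xy; apply/eqP; rewrite -subr_eq0; apply/eqP/Tinj0.
  by exists 0%N => n _; rewrite linearB xy subrr.
have Tapprox y e : range T y -> 0 < e ->
    exists n c, 0 < c /\ `|c *: T (l1_basis n) - y| <= e.
  move=> [a _ <-] e0; have eD : 0 < e / (D + 1) by rewrite divr_gt0// ltr_wpDl.
  have [n [c [c0 cn]]] := Ad (M^-1 *: A a) _ eD.
  exists n, (c * M); split; first exact: mulr_gt0.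
  (* The factor [M] cancels the scaling of [T] on the basis vector; for [T a] the scaling was
     absorbed in the approximated vector. *)
  have -> : (c * M) *: T (l1_basis n) - T a = Phi (c *: A (l1_basis n) - M^-1 *: A a).
    by rewrite [RHS]linearB [Phi (c *: _)]linearZ [Phi (M^-1 *: _)]linearZ -scalerA TM.
  rewrite (le_trans (PhiD _))// (le_trans (ler_wpM2l D0 cn))// mulrCA ler_piMr ?(ltW e0)//.
  by rewrite ler_pdivrMr ?ltr_wpDl// mul1r lerDl.
exists T; split.
- split=> //; apply/le_anti/andP; split.
    apply: sup_le_ub0 => // _ [x x1 <-].
    by rewrite TE normrZ gtr0_norm// mulrC ler_pdivrMr// mul1r MB.
  have : M <= M * op_norm T.
    apply: sup_le_ub0 => [|_ [x x1 <-]].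
      rewrite mulr_ge0 ?(ltW M0)//; apply: (@sup_ub_le _ _ (D * B * M^-1)).
        move=> _ [y y1 <-]; rewrite TE normrZ gtr0_norm// mulrC ler_pM2r//.
        by rewrite (le_trans (T0B y))// ler_piMr// mulr_ge0.
      by exists 0; [rewrite /= normr0|rewrite linear0 normr0].
    rewrite -TM normrZ gtr0_norm// ler_wpM2l ?(ltW M0)//.
    apply: (@sup_ub_le _ _ (D * B * M^-1)); last by exists x.
    move=> _ [y y1 <-]; rewrite TE normrZ gtr0_norm// mulrC ler_pM2r//.
    by rewrite (le_trans (T0B y))// ler_piMr// mulr_ge0.
  by rewrite -[leLHS]mulr1 ler_pM2l.
- split.
  + exists (range (fun s => T (rat_l1 s))); split.
    * exact: sub_countable (card_image_le _ _) (countableP _).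
    * by move=> _ [s _ <-]; exists (rat_l1 s).
    * move=> _ [b _ <-] N /nbhs_normP[e /= e0 eN].
      have [K K0 TK] := (bounded_linearP T).1 Tc.
      have eK : 0 < e / (K + 1) by rewrite divr_gt0// ltr_wpDl.
      have [s sb] := rat_l1_dense b eK.
      exists (T (rat_l1 s)); split; first by exists s.
      apply: eN; change (`|T b - T (rat_l1 s)| < e).
      rewrite distrC -linearB (le_lt_trans (TK _))// (le_lt_trans (ler_wpM2l K0 sb))// mulrCA gtr_pMr//.
      by rewrite ltr_pdivrMr ?ltr_wpDl// mul1r ltrDl.
  + apply: total_weak_star_dense; first exact: range_subspace.
    move=> x Yx; apply: G_total => k.
    have [E [Ec EE]] := l1_map_eval x Phic; have [K K0 EK] := (bounded_linearP E).1 Ec.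
    rewrite -PhiE -EE; apply/normr0_eq0/le_anti; rewrite normr_ge0 andbT.
    apply/ler_addgt0Pr => e e0; rewrite add0r.
    have eK : 0 < e / (K + 1) by rewrite divr_gt0// ltr_wpDl.
    (* [G k x] is the value of [E] at [l1_basis k], a limit of multiples of columns of [A], on all
       of which [E] vanishes. *)
    have [n [c [_ cn]]] := Ad (l1_basis k) _ eK.
    have En : E (c *: A (l1_basis n)) = 0.
      have Tn : T (l1_basis n) x = 0 by apply: Yx; exists (l1_basis n).
      rewrite EE linearZ -[Phi _]/(T0 _) -TM.
      by change (c * (M * T (l1_basis n) x) = 0); rewrite Tn !mulr0.
    rewrite -normrN -[- E _]add0r -En -linearB (le_trans (EK _))//.
    rewrite (le_trans (ler_wpM2l K0 cn))// mulrCA ler_piMr ?(ltW e0)//.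
    by rewrite ler_pdivrMr ?ltr_wpDl// mul1r lerDl.
  + exists (l1 R : completeNormedModType R), T.
    split; [exact: l1_infinite_dimensional|exact: Tc|exact: Tinj|by []].
  + apply/seteqP; split=> [f [/span_NA_vanishes fN [a _ aE]]|_ ->].
      by move: fN; rewrite -aE => /Tinj0 ->; rewrite linear0.
    split; last by exists 0; rewrite ?linear0.
    by case: (@lin_span_subspace _ _ (NA (@Num.norm R W))).
- move=> y [Yy y1] N /nbhs_normP[e /= e0 eN].
  (* Normalizing doubles the error, to [e / 2]; the positive factor [c] disappears in the
     process. *)
  have e4 : 0 < e / 4 by rewrite divr_gt0.
  have [n [c [c0 cn]]] := Tapprox y (e / 4) Yy e4.
  exists (`|T (l1_basis n)|^-1 *: T (l1_basis n)); split; first by exists n.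
  apply: eN; change (`|y - `|T (l1_basis n)|^-1 *: T (l1_basis n)| < e); rewrite distrC.
  have := normalize_dist y1 cn.
  rewrite normrZ gtr0_norm// scalerA invfM mulrAC mulVf ?gt_eqF// mul1r.
  by move=> /le_lt_trans; apply; lra.
Qed.

Lemma read_construction_exists : exists p : W -> R, read_construction p.
Proof.
have [T [Tall mw Td]] := weak_star_modest_operator.
have [Tc _ _] := Tall; have [D D0 TD] := (bounded_linearP T).1 Tc.
pose r n : R := geometric 1 2^-1 n.
have r0 n : 0 < r n by rewrite /r /geometric/= mul1r exprn_gt0// invr_gt0.
have rc : cvgn (series r).
  by apply: is_cvg_geometric_series; rewrite ger0_norm ?invr_ge0// invf_lt1// ltr1n.
have /choice[S SE] : forall x : W, exists s : l1 R, forall n,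
    s n = r n * T (l1_basis n) x.
  move=> x.
  have rs : (fun n => r n * T (l1_basis n) x : R) \in summable_seq.
    apply/summable_seqP; exists (limn (series r) * (D * `|x|)) => N.
    rewrite (@le_trans _ _ (\sum_(0 <= n < N) r n * (D * `|x|)))//.
      apply: ler_sum => n _; rewrite normrM gtr0_norm// ler_wpM2l// ?(ltW (r0 n))//.
      rewrite (le_trans (ler_dual _ _))// ler_wpM2r//.
      by rewrite (le_trans (TD _))// ler_piMr// l1_basis_norm_le1.
    rewrite -mulr_suml ler_wpM2r// ?mulr_ge0//.
    apply: (nondecreasing_cvgn_le _ rc).
    by apply: nondecreasing_series => n _ _; exact: ltW.
  by exists (L1 rs).
by exists (fun x => `|x| + `|S x|), T, r, S.
Qed.

End construction.

Theorem theorem4p1 (R : realType) (X : completeNormedModType R)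
    (X_c0 : contains_c0 X)
    (X_norming : exists xs : nat -> dual X, countable_norming_system xs) :
  exists (Xt : completeNormedModType R) (phi : {linear X -> Xt}),
    [/\ isomorphism phi,
        weak_star_modest (lin_span (NA (@Num.norm R Xt))),
        exists p : Xt -> R, read_construction p
      & forall p : Xt -> R, read_construction p ->
          read_norm p /\ read_norm (p \o phi)].
Proof.
have [xs xsN] := X_norming.
have [G [u [[C GC] [K K0 GK] Gu]]] := biorthogonal_norming_system X_c0 xsN.
pose qN := flat_norm_equivalent GC K0 GK.
pose W : completeNormedModType R := renormed qN.
have [phi [phi_iso phiE phi_norm]] := renormed_isomorphism qN.
have normE (x : W) : `|x| = flat_norm G x by rewrite -(phi_norm x) phiE.
(* The functionals must be rebuilt as elements of the dual of [W]; there their norms are at most 1,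
   because the new norm dominates each of them. *)
have /choice[H HE] : forall n, exists h : dual W, forall x : W, h x = G n x.
  move=> n; pose g (x : W) : R^o := G n x.
  have gl : linear g by move=> a x y; exact: dual_linear.
  pose g' : {linear W -> R^o} := HB.pack g (GRing.isLinear.Build _ _ _ _ _ gl).
  apply: (@dual_of_linear _ _ g' 1) => x.
  by rewrite mul1r normE (le_trans (ler_norm _))// (flat_norm_ub GC).
have HC n : `|H n| <= 1.
  apply: dual_norm_le => // x x1; rewrite HE (le_trans _ x1)// normE.
  exact: flat_norm_ub GC _ _.
have H_total (x : W) : (forall n, H n x = 0) -> x = 0.
  move=> Hx; apply: (@normr0_eq0 _ X); apply/le_anti; rewrite normr_ge0 andbT.
  by rewrite -(mulr0 K); apply: (GK _ 0) => n; rewrite -HE Hx normr0.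
have Hu i k : H i (u k : W) = (i == k.*2)%:R by rewrite HE Gu.
have NA_u (f : dual W) : NA (@Num.norm R W) f ->
    exists N, forall n, (N <= n)%N -> f (u n) = 0.
  apply: NA_vanishes => x; rewrite normE => /(flat_norm_perturb GC Gu)[N xN].
  by exists N => n a Nn a4; rewrite normE; exact: xN.
exists W, phi; split=> //.
- split; first exact: lin_span_subspace.
  have [T [_ mw _]] := weak_star_modest_operator HC H_total Hu NA_u.
  by exists (range T).
- exact: read_construction_exists HC H_total Hu NA_u.
- move=> p /read_construction_read_norm pR; split=> //.
  exact: read_norm_isomorphism.
Qed.
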